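(* There is an absolute constant $C>0$ such that the following holds. Let $f:\mathbb{R}^d\to\mathbb{R}$ be convex, twice differentiable and $(L_0,L_1)$-smooth, attaining its minimum at some $x^\star\in\mathbb{R}^d$ with $R_0:=\|x_0-x^\star\|\le R$. Let $\mathcal{G}$ be an unbiased stochastic gradient oracle for $f$ satisfying, for every $x\in\mathbb{R}^d$, $\mathbb{E}\left[\exp\left(\|\mathcal{G}(x)-\nabla f(x)\|^2/\sigma^2\right)\right]\le \exp(1)$. Let $\delta\in(0,1)$ and let $T$ be a positive integer with $$T\ \ge\ \log_+\left(\tfrac{T}{\delta}\right)(64L_1R_0)^2 .$$ Let $\bar x$ be the output of Clipped SGD With Double Sampling (defined in the context) run for $T$ steps from $x_0$, where $(\eta_t,\alpha_t,c)$ are chosen according to any one of the three methods ''standard clipping'', ''implicit clipping'', ''conservative clipping'' (defined in the context) with $\sigma'=3\sqrt{\log(T/\delta)}\,\sigma$. Then with probability at least $1-2\delta$, $$f(\bar x)-f(x^\star)\ \le\ C\cdot\frac{\log_+\left(\frac{T}{\delta}\right)\left(L_0R_0^2+\sqrt{\log\left(\frac{T}{\delta}\right)}\,\sigma R_0\sqrt{T}\right)}{T}.$$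
   Context: Norms are Euclidean, $\log$ is the natural logarithm and $\log_+(u):=2+\log(u)$. $\mathbb{B}(x,r)$ is the Euclidean ball of radius $r$ centered at $x$, and $\mathrm{Proj}_{\mathcal X}$ is the Euclidean projection onto $\mathcal X$. The parameters $L_0,L_1,\sigma,R_0$ are positive and $R\in(0,\infty]$; when $R=\infty$, $\mathrm{Proj}_{\mathbb{B}(x_0,R)}$ is the identity (no projection). A twice-differentiable $f:\mathbb{R}^d\to\mathbb{R}$ is $(L_0,L_1)$-smooth if $\|\nabla^2 f(x)\|\le L_0+L_1\|\nabla f(x)\|$ for all $x\in\mathbb{R}^d$ (operator norm of the Hessian). A stochastic gradient oracle $\mathcal{G}$ returns, on query $x$, a random vector $\mathcal{G}(x)\in\mathbb{R}^d$, using fresh independent randomness in each query; it is unbiased if $\mathbb{E}[\mathcal{G}(x)]=\nabla f(x)$ for all $x$. Clipped SGD With Double Sampling, with step size rule $\eta_t$, clipping rule $\alpha_t$ and threshold $c$: start from $x_0$ and $\mathcal{T}_1=\mathcal{T}_2=\emptyset$. For $t=0,1,\dots,T-1$: query the oracle at $x_t$ to get $g_t^c$; compute $\alpha_t$ and $\eta_t$ using $g_t^c$; if $c\le\|g_t^c\|$ add $t$ to $\mathcal{T}_1$, otherwise add $t$ to $\mathcal{T}_2$; query the oracle at $x_t$ a second time, independently, to get $g_t$; set $x_{t+1}=\mathrm{Proj}_{\mathbb{B}(x_0,R)}(x_t-\eta_t\alpha_t g_t)$. Output $\bar x=\frac1{|\mathcal{T}_2|}\sum_{t\in\mathcal{T}_2}x_t$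 if $\mathcal{T}_2\ne\emptyset$, and $\bar x=x_0$ otherwise. The three methods: - Standard clipping: $\eta_t=\frac1{16}\min\left\{\frac1{11L_0},\frac1{L_0+\sigma'\sqrt T/R_0}\right\}$, $\alpha_t=\min\{1,c/\|g_t^c\|\}$, $c=\frac1{L_1}\max\left\{10L_0,\frac{\sqrt T}{R_0}\sigma'\right\}$. - Implicit clipping: $\eta_t=\frac18\left(L_0+\|g_t^c\|L_1+\frac{\sigma'\sqrt T}{R_0}\right)^{-1}$, $\alpha_t=1$, $c=\frac1{L_1}\max\left\{10L_0,\frac{\sqrt T}{R_0}\sigma'\right\}$. - Conservative clipping: $\eta_t=\frac1{16}\min\left\{\frac1{11L_0},\frac1{L_0+\sigma'\sqrt T/R_0}\right\}$, $\alpha_t=\min\{1,c/\|g_t^c\|\}$, $c=64\sqrt{\log_+\left(\frac T\delta\right)}\,\frac{R_0}{\sqrt T}\max\left\{10L_0,\frac{\sqrt T}{R_0}\sigma'\right\}$. *)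

(* Defs.v *)
From HB Require Import structures.
From mathcomp Require Import all_boot all_order all_algebra finmap.
From mathcomp Require Import all_classical all_reals all_analysis.

Set Implicit Arguments.
Unset Strict Implicit.
Unset Printing Implicit Defensive.

Import Order.TTheory GRing.Theory Num.Theory.
Import numFieldNormedType.Exports.

Local Open Scope classical_set_scope.
Local Open Scope ring_scope.

Section Euclidean.
Context {R : realType}.

(* The canonical norm `|x| on 'rV[R]_d is the sup norm, hence this one. The
   two are equivalent, so [open] and [differentiable] keep their usual
   meaning. *)
Definition enorm d (x : 'rV[R]_d) : R := Num.sqrt (\sum_i x 0 i ^+ 2).

(* r : \bar R, and the ball is the whole space when r = +oo. *)
Definition eball d (x : 'rV[R]_d) (r : \bar R) : set 'rV[R]_d :=
  [set y | ((enorm (y - x))%:E <= r)%E].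

(* The point of X closest to x; in particular eproj setT is the identity. *)
Definition eproj d (X : set 'rV[R]_d) (x : 'rV[R]_d) : 'rV[R]_d :=
  xget x [set p | X p /\ forall y, X y -> enorm (x - p) <= enorm (x - y)].

Definition opnorm d (A : 'M[R]_d) : R :=
  sup [set enorm (v *m A) | v in [set v | enorm v <= 1]].

Definition grad d (f : 'rV[R]_d -> R) (x : 'rV[R]_d) : 'rV[R]_d :=
  \row_i 'D_(delta_mx 0 i) f x.

Definition hessian d (f : 'rV[R]_d -> R) (x : 'rV[R]_d) : 'M[R]_d :=
  'J (grad f) x.

Definition twice_differentiable d (f : 'rV[R]_d -> R) : Prop :=
  (forall x, differentiable f x) /\ (forall x, differentiable (grad f) x).

Definition L0L1_smooth (L0 L1 : R) d (f : 'rV[R]_d -> R) : Prop :=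
  forall x, opnorm (hessian f x) <= L0 + L1 * enorm (grad f x).

Definition is_convex d (f : 'rV[R]_d -> R) : Prop :=
  convex_function (setT : set (convex_lmodType 'rV[R]_d)) f.

End Euclidean.

Definition borel_rV (R : realType) (d : nat) :=
  g_sigma_algebraType (@open 'rV[R]_d).

(* An oracle is a function G of the query point and of a random seed with law
   mu: the answer to a query at x is G x s, with s drawn from mu afresh for each
   query. *)
Section Oracle.
Context {R : realType} {dS : measure_display} {S : measurableType dS}.
Context {d : nat}.
Implicit Types (mu : probability S R) (G : 'rV[R]_d -> S -> 'rV[R]_d).

Definition measurable_oracle G : Prop :=
  measurable_fun [set: borel_rV R d * S]
    (fun p : borel_rV R d * S => G p.1 p.2 : borel_rV R d).

Definition unbiased_oracle mu G (f : 'rV[R]_d -> R) : Prop :=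
  forall x i, ('E_mu[(fun s => G x s 0 i)%R] = (grad f x 0 i)%:E)%E.

Definition subgaussian_oracle mu G (f : 'rV[R]_d -> R) (sigma : R) : Prop :=
  forall x,
    ('E_mu[(fun s => expR (enorm (G x s - grad f x) ^+ 2 / sigma ^+ 2))%R]
       <= (expR 1)%:E)%E.

End Oracle.

Section Independence.
Context {R : realType} {dO dS : measure_display}.
Context {Omega : measurableType dO} {S : measurableType dS}.
Variable P : probability Omega R.

Definition mutually_independent (I : choiceType)
    (X : I -> {mfun Omega >-> S}) : Prop :=
  forall (J : {fset I}) (A : I -> set S), (forall i, measurable (A i)) ->
    (P (\bigcap_(i in [set` J]) (X i @^-1` A i)) =
     \prod_(i <- J) P (X i @^-1` A i))%E.

Definition iid (mu : probability S R) (X : nat -> {mfun Omega >-> S}) : Prop :=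
  (forall k (A : set S), measurable A -> distribution P (X k) A = mu A) /\
  mutually_independent X.

End Independence.

(* The seeds of the successive queries are s 0, s 1, s 2, ...: step t uses
   s (2 t) for g_t^c and s (2 t + 1) for g_t. *)
Section ClippedSGD.
Context {R : realType} {d : nat} {S : Type}.
Variable G : 'rV[R]_d -> S -> 'rV[R]_d.
Variables (eta alpha : 'rV[R]_d -> R) (c : R).
Variables (r : \bar R) (x0 : 'rV[R]_d) (s : nat -> S).

Fixpoint sgd_iterate (t : nat) : 'rV[R]_d :=
  if t is t'.+1 then
    let x := sgd_iterate t' in
    let gc := G x (s t'.*2) in
    let g := G x (s t'.*2.+1) in
    eproj (eball x0 r) (x - (eta gc * alpha gc) *: g)
  else x0.

Definition sgd_T2 (T : nat) : {set 'I_T} :=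
  [set t : 'I_T | enorm (G (sgd_iterate t) (s t.*2)) < c]%SET.

Definition sgd_output (T : nat) : 'rV[R]_d :=
  if sgd_T2 T == finset.set0 then x0
  else #|sgd_T2 T|%:R^-1 *: \sum_(t in sgd_T2 T) sgd_iterate t.

End ClippedSGD.

Inductive clipping_method :=
  | StandardClipping | ImplicitClipping | ConservativeClipping.

Section Methods.
Context {R : realType}.

Definition log_plus (u : R) : R := 2 + ln u.

Variables (m : clipping_method) (L0 L1 R0 sigma' delta : R) (T : nat).

Definition clip_threshold : R :=
  let b := Num.max (10 * L0) (Num.sqrt T%:R / R0 * sigma') in
  match m with
  | StandardClipping | ImplicitClipping => L1^-1 * b
  | ConservativeClipping =>
      64 * Num.sqrt (log_plus (T%:R / delta)) * (R0 / Num.sqrt T%:R) * b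
  end.

Definition step_size {d : nat} (gc : 'rV[R]_d) : R :=
  match m with
  | StandardClipping | ConservativeClipping =>
      16^-1 * Num.min (11 * L0)^-1 (L0 + sigma' * Num.sqrt T%:R / R0)^-1
  | ImplicitClipping =>
      8^-1 * (L0 + enorm gc * L1 + sigma' * Num.sqrt T%:R / R0)^-1
  end.

(* min{1, c / ||gc||} is 1 at gc = 0, whereas c / 0 = 0 in the library. *)
Definition clip_factor {d : nat} (gc : 'rV[R]_d) : R :=
  match m with
  | StandardClipping | ConservativeClipping =>
      if gc == 0 then 1 else Num.min 1 (clip_threshold / enorm gc)
  | ImplicitClipping => 1
  end.

End Methods.

(* Main.v *)
Require Import Defs.
From HB Require Import structures.
From mathcomp Require Import all_boot all_order all_algebra finmap.
From mathcomp Require Import all_classical all_reals all_analysis measurable_realfun.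
From mathcomp Require Import ring lra.
Import Order.TTheory GRing.Theory Num.Theory.
Import numFieldNormedType.Exports.
Local Open Scope classical_set_scope.
Local Open Scope ring_scope.

(* Write gap = f x - f xstar and A = sigma' sqrt T / R0. Convexity and
   (L0,L1)-smoothness give |grad f|^2 <= 6 (L0 + L1 |grad f|) gap. Since sigma'
   is at most c / 64, in all three methods the effective step g = eta alpha
   satisfies g (L0 + L1 |grad f|) <= 1/8 and g A <= 1/8 as soon as the clipping
   query is sigma'-accurate, and then
     D_{t+1}^2 <= D_t^2 - g gap / 2 + R0^2 / (32 T) + 2 g <noise, xstar - x_t>
   for D_t = |x_t - xstar|. Given the past and the clipping query the last term
   is centered and subgaussian, because the second query is fresh; a Chernoff
   bound on its partial sums keeps D_t <= 2 R0 and yields sum g gap <= 8 R0^2.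
   A clipped step contributes at least 16 R0^2 / T to that sum, so at least half
   of the steps are unclipped, and for those g is bounded below by
   1 / (16 (11 L0 + 2 A)). *)

(** The Chernoff bound and the distance bound need each other: the noise term has a usable
    subgaussian constant only while x_t stays near [xstar], and it stays there only if the noise
    sums are small. The walk is therefore built from a drift cut off outside the ball of radius 2
    R0, so that its moment generating function is bounded unconditionally; an induction along each
    good run then shows that the cutoff never acts. With L = ln (T / delta), the Chernoff parameter
    L / R0^2 turns the threshold 2 R0^2 into 2 L, while all T steps together cost only L / 18,
    because g sigma' sqrt T <= R0 / 8 with sigma' = 3 sqrt L sigma. A partial sum thus fails with
    probability at most exp (- 35 L / 18). The factor 3 in sigma' makes each query inaccurate with
    probability at most exp (1 - 9 L). For delta < 1/2, the two queries and the partial sum of one t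
    fail with probability at most 2 exp (- L) = 2 delta / T, and a union bound over t gives 2 delta.
    Outside these events the argument is deterministic, for one fixed sequence of seeds. *)

(** * Euclidean inner product and projection onto balls *)

Section EuclideanGeometry.
Context {R : realType} {d : nat}.
Implicit Types (u v w x y p q : 'rV[R]_d) (a b : R).

Definition edot u v : R := \sum_i u 0 i * v 0 i.

Lemma edotC u v : edot u v = edot v u.
Proof. by apply: eq_bigr => i _; rewrite mulrC. Qed.

Lemma edotDl u v w : edot (u + v) w = edot u w + edot v w.
Proof. by rewrite -big_split; apply: eq_bigr => i _; rewrite mxE mulrDl. Qed.

Lemma edotZl a u v : edot (a *: u) v = a * edot u v.
Proof. by rewrite mulr_sumr; apply: eq_bigr => i _; rewrite mxE mulrA. Qed.

Lemma edotNl u v : edot (- u) v = - edot u v.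
Proof. by rewrite -scaleN1r edotZl mulN1r. Qed.

Lemma edotBl u v w : edot (u - v) w = edot u w - edot v w.
Proof. by rewrite edotDl edotNl. Qed.

Lemma edotDr u v w : edot u (v + w) = edot u v + edot u w.
Proof. by rewrite !(edotC u) edotDl. Qed.

Lemma edotZr a u v : edot u (a *: v) = a * edot u v.
Proof. by rewrite !(edotC u) edotZl. Qed.

Lemma edotNr u v : edot u (- v) = - edot u v.
Proof. by rewrite !(edotC u) edotNl. Qed.

Lemma edotBr u v w : edot u (v - w) = edot u v - edot u w.
Proof. by rewrite edotDr edotNr. Qed.

Lemma edot0l u : edot 0 u = 0.
Proof. by apply: big1 => i _; rewrite mxE mul0r. Qed.

Lemma edot_suml (I : Type) (r : seq I) (P : pred I) (F : I -> 'rV[R]_d) v :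
  edot (\sum_(i <- r | P i) F i) v = \sum_(i <- r | P i) edot (F i) v.
Proof.
elim/big_ind2: _ => [|u1 a u2 b <- <-|//]; first exact: edot0l.
by rewrite edotDl.
Qed.

Lemma edot_ge0 u : 0 <= edot u u.
Proof. by apply: sumr_ge0 => i _; rewrite -expr2 sqr_ge0. Qed.

Lemma enorm_ge0 u : 0 <= enorm u.
Proof. exact: sqrtr_ge0. Qed.

Lemma enorm_sqr u : enorm u ^+ 2 = edot u u.
Proof.
rewrite sqr_sqrtr; first by apply: eq_bigr => i _; rewrite expr2.
by apply: sumr_ge0 => i _; rewrite sqr_ge0.
Qed.

Lemma enorm_eq0 u : (enorm u == 0) = (u == 0).
Proof.
apply/idP/eqP => [|->]; last first.
  by rewrite -sqrf_eq0 enorm_sqr edot0l.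
rewrite -sqrf_eq0 enorm_sqr /edot psumr_eq0; last first.
  by move=> i _; rewrite -expr2 sqr_ge0.
move=> /allP h; apply/rowP => i; rewrite mxE; apply/eqP.
by rewrite -sqrf_eq0 expr2; exact: (h i (mem_index_enum _)).
Qed.

Lemma enorm0 : enorm (0 : 'rV[R]_d) = 0.
Proof. by apply/eqP; rewrite enorm_eq0. Qed.

Lemma edot_le_enorm u v : edot u v <= enorm u * enorm v.
Proof.
have [->|v0] := eqVneq v 0.
  by rewrite edotC edot0l enorm0 mulr0.
have [->|u0] := eqVneq u 0.
  by rewrite edot0l enorm0 mul0r.
have nu : 0 < enorm u by rewrite lt_neqAle eq_sym enorm_eq0 u0 enorm_ge0.
have nv : 0 < enorm v by rewrite lt_neqAle eq_sym enorm_eq0 v0 enorm_ge0.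
have := edot_ge0 (enorm v *: u - enorm u *: v).
rewrite !(edotBl, edotBr, edotZl, edotZr) -!enorm_sqr (edotC v u) => h.
have {}h : 0 <= (2 * (enorm u * enorm v)) * (enorm u * enorm v - edot u v).
  by move: h; congr (_ <= _); ring.
by move: h; rewrite pmulr_rge0 ?subr_ge0// mulr_gt0// mulr_gt0.
Qed.

Lemma normr_edot u v : `|edot u v| <= enorm u * enorm v.
Proof.
rewrite ler_norml edot_le_enorm andbT lerNl -edotNl (le_trans (edot_le_enorm _ _))//.
by rewrite /enorm; under eq_bigr do rewrite mxE sqrrN.
Qed.

Lemma enormN u : enorm (- u) = enorm u.
Proof. by rewrite /enorm; under eq_bigr do rewrite mxE sqrrN. Qed.

Lemma enormB u v : enorm (u - v) = enorm (v - u).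
Proof. by rewrite -enormN opprB. Qed.

Lemma enormZ a u : enorm (a *: u) = `|a| * enorm u.
Proof.
apply/eqP; rewrite -(@eqrXn2 _ 2)// ?enorm_ge0 ?mulr_ge0 ?enorm_ge0//.
by rewrite exprMn !enorm_sqr edotZl edotZr mulrA -expr2 -normrX ger0_norm ?sqr_ge0.
Qed.

Lemma enormD u v : enorm (u + v) <= enorm u + enorm v.
Proof.
rewrite -(@ler_pXn2r _ 2)// ?nnegrE ?addr_ge0 ?enorm_ge0//.
rewrite sqrrD !enorm_sqr edotDl !edotDr (edotC v u).
have := edot_le_enorm u v; rewrite mulr2n; lra.
Qed.

Lemma enorm_sqrD u v :
  enorm (u + v) ^+ 2 = enorm u ^+ 2 + 2 * edot u v + enorm v ^+ 2.
Proof. by rewrite !enorm_sqr edotDl !edotDr (edotC v u); ring. Qed.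

Lemma normr_le_enorm u i : `|u 0 i| <= enorm u.
Proof.
rewrite -sqrtr_sqr ler_wsqrtr// (bigD1 i)//= lerDl.
by apply: sumr_ge0 => j _; rewrite sqr_ge0.
Qed.

(** The obtuse angle condition sharpens to |x - q|^2 + |p - q|^2 <= |x - p|^2 for p in X. This shows
    both that q is a minimizer and that whichever minimizer [xget] picks equals q. *)
Lemma eproj_unique (X : set 'rV[R]_d) x q : X q ->
  (forall y, X y -> edot (x - q) (y - q) <= 0) -> eproj X x = q.
Proof.
move=> Xq xq; rewrite /eproj.
have pyth p : X p -> enorm (x - q) ^+ 2 + enorm (p - q) ^+ 2 <= enorm (x - p) ^+ 2.
  move=> Xp; have -> : x - p = (x - q) + - (p - q) by rewrite opprB subrKA.
  rewrite (enorm_sqrD (x - q)) edotNr enormN; have := xq _ Xp; lra.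
case: xgetP => [p _ [Xp pmin]|/(_ q)[]]; last first.
  split=> // y Xy; rewrite -(@ler_pXn2r _ 2)// ?nnegrE ?enorm_ge0//.
  by have := pyth _ Xy; have := sqr_ge0 (enorm (y - q)); lra.
apply/eqP; rewrite -subr_eq0 -enorm_eq0 -sqrf_eq0.
have := pmin _ Xq; rewrite -(@ler_pXn2r _ 2)// ?nnegrE ?enorm_ge0// => h.
rewrite eq_le sqr_ge0 andbT; have := pyth _ Xp; lra.
Qed.

Lemma eproj_setT x : eproj setT x = x.
Proof. by apply: eproj_unique => // y _; rewrite subrr edot0l. Qed.

(** Closed form of the projection onto a ball of finite radius. Since [eproj] is defined by choice,
    its measurability is read off from this formula. *)
Definition clamp a x0 y : 'rV[R]_d :=
  if enorm (y - x0) <= a then y else x0 + (a / enorm (y - x0)) *: (y - x0).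

(** Outside the ball, y minus its clamp is a nonnegative multiple of z = y - x0, and <z, p - x0> <=
    a |z| = <z, k z> by Cauchy-Schwarz. *)
Lemma eball_edot_clamp a x0 y p : 0 < a -> enorm (p - x0) <= a ->
  edot (y - clamp a x0 y) (p - clamp a x0 y) <= 0.
Proof.
move=> a0 pa; rewrite /clamp; case: (leP (enorm (y - x0)) a) => ya.
  by rewrite subrr edot0l.
set z := y - x0; set k := _ / _.
have z0 : 0 < enorm z := lt_trans a0 ya.
have -> : y - (x0 + k *: z) = (1 - k) *: z.
  by rewrite scalerBl scale1r opprD addrA.
have -> : p - (x0 + k *: z) = (p - x0) - k *: z by rewrite opprD addrA.
rewrite edotZl edotBr edotZr -enorm_sqr.
have -> : k * enorm z ^+ 2 = a * enorm z by rewrite /k; field; rewrite gt_eqF.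
rewrite mulr_ge0_le0//.
  by rewrite subr_ge0 ler_pdivrMr// mul1r ltW.
rewrite subr_le0 (le_trans (edot_le_enorm _ _))// mulrC.
by rewrite ler_wpM2r// ltW.
Qed.

Lemma clamp_eball a x0 y : 0 < a -> enorm (clamp a x0 y - x0) <= a.
Proof.
move=> a0; rewrite /clamp; case: (leP (enorm (y - x0)) a) => // ya.
rewrite addrC addKr enormZ ger0_norm ?divr_ge0 ?enorm_ge0 ?(ltW a0)//.
by rewrite divfK// gt_eqF// (lt_trans a0).
Qed.

Lemma eproj_eball a x0 y : 0 < a -> eproj (eball x0 a%:E) y = clamp a x0 y.
Proof.
move=> a0; apply: eproj_unique; first by rewrite /eball /= lee_fin clamp_eball.
by move=> p; rewrite /eball /= lee_fin => pa; exact: eball_edot_clamp.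
Qed.

Lemma eproj_eball_nonexpansive (r : \bar R) x0 y p : (0 < r)%E ->
  ((enorm (p - x0))%:E <= r)%E ->
  enorm (eproj (eball x0 r) y - p) <= enorm (y - p).
Proof.
case: r => [a| |]; last 2 first.
- move=> _ _; have -> : eball x0 +oo%E = setT.
    by apply/seteqP; split => // z _; rewrite /eball /= leey.
  by rewrite eproj_setT.
- by [].
rewrite lte_fin => a0; rewrite lee_fin => pa; rewrite eproj_eball//.
rewrite -(@ler_pXn2r _ 2)// ?nnegrE ?enorm_ge0//.
set q := clamp _ _ _.
have -> : y - p = (y - q) + - (p - q) by rewrite opprB subrKA.
rewrite (enorm_sqrD (y - q)) edotNr enormN (enormB p q).
have := @eball_edot_clamp a x0 y p a0 pa; rewrite -/q.
by have := sqr_ge0 (enorm (y - q)); lra.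
Qed.

End EuclideanGeometry.

(** * Consequences of convexity and (L0,L1)-smoothness *)

Section Smoothness.
Context {R : realType} {d : nat}.
Implicit Types (u v w x y : 'rV[R]_d) (f : 'rV[R]_d -> R).

Lemma edot_continuous v : continuous (edot v).
Proof.
apply: continuous_big => [|i _]; first exact: add_continuous.
move=> x; apply: (continuousM (s := fun=> v 0 i) (t := fun y : 'rV[R]_d => y 0 i)).
  exact: cst_continuous.
exact: coord_continuous.
Qed.

Lemma enorm_continuous : continuous (@enorm R d).
Proof.
move=> x; apply: (continuous_comp (f := fun x => \sum_i x 0 i ^+ 2)).
  apply: continuous_big => [|i _ y]; first exact: add_continuous.
  apply: (continuous_comp (f := fun x : 'rV[R]_d => x 0 i) (g := fun a : R => a ^+ 2)).
    exact: coord_continuous.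
  exact: exprn_continuous.
exact: sqrt_continuous.
Qed.

Lemma enorm_mulmx_le_opnorm (A : 'M[R]_d) v :
  enorm (v *m A) <= opnorm A * enorm v.
Proof.
have [->|v0] := eqVneq v 0; first by rewrite mul0mx enorm0 mulr0.
have nv : 0 < enorm v by rewrite lt_neqAle eq_sym enorm_eq0 v0 enorm_ge0.
rewrite -ler_pdivrMr// mulrC.
have -> : (enorm v)^-1 * enorm (v *m A) = enorm (((enorm v)^-1 *: v) *m A).
  by rewrite -scalemxAl enormZ ger0_norm// invr_ge0 enorm_ge0.
apply: ub_le_sup => /=; last first.
  exists ((enorm v)^-1 *: v) => //=.
  by rewrite enormZ ger0_norm ?invr_ge0 ?enorm_ge0// mulVf// enorm_eq0.
(* The set under the [sup] is bounded by the Frobenius norm of [A], by Cauchy-Schwarz on each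
   column. *)
exists (Num.sqrt (\sum_j enorm (row j A^T) ^+ 2)) => _ /= [u u1 <-].
rewrite ler_wsqrtr//; apply: ler_sum => j _.
have -> : (u *m A) 0 j = edot u (row j A^T).
  by rewrite !mxE; apply: eq_bigr => i _; rewrite !mxE.
rewrite -[leLHS]real_normK ?num_real// ler_pXn2r ?nnegrE ?enorm_ge0//.
apply: (le_trans (normr_edot _ _)); rewrite -[leRHS]mul1r.
by rewrite ler_wpM2r// enorm_ge0.
Qed.

Lemma derive_edot_grad f x v : differentiable f x -> 'D_v f x = edot (grad f x) v.
Proof.
move=> df; rewrite deriveE// {1}(row_sum_delta v) linear_sum.
by apply: eq_bigr => i _; rewrite linearZ /= mxE deriveE// mulrC.
Qed.

(** For t in (0, 1] the difference quotients of f at x along [y - x] are at most [f y - f x], and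
    the bound passes to the limit at 0 from the right. *)
Lemma convex_grad_le f x y : is_convex f -> differentiable f x ->
  f x + edot (grad f x) (y - x) <= f y.
Proof.
move=> cf df; rewrite addrC -lerBrDr -derive_edot_grad//.
have /cvg_dnbhs_at_right h := diff_derivable (v := y - x) df.
apply: (cvgr_to_le h); near=> t.
have t0 : 0 < t by near: t; exact: nbhs_right_gt.
have t1 : t <= 1 by near: t; exact: nbhs_right_ltW.
have t01 : Itv.spec (@Itv.num_sem R) (Itv.Real `[0%Z, 1%Z]) t.
  by rewrite /Itv.spec /= /Itv.num_sem /= in_itv /= (ltW t0) t1 num_real.
have := cf (Itv.mk t01) y x (in_setT _) (in_setT _).
rewrite /conv /= /conv /= /unstable.onem => H.
rewrite /GRing.scale /= -ler_pdivlMl ?invr_gt0// invrK.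
have -> : t *: (y - x) + x = t *: y + (1 - t) *: x.
  by rewrite scalerBr scalerBl scale1r addrAC -addrA.
by rewrite lerBlDr (le_trans H)// /GRing.scale /=; lra.
Unshelve. all: by end_near. Qed.

(** Pairing the vector field with a fixed [w] gives a scalar function, to which the mean value
    theorem applies. *)
Lemma is_derive_edot_line (F : 'rV[R]_d -> 'rV[R]_d) x v w (s : R) :
  differentiable F (x + s *: v) ->
  is_derive s 1 (fun t => edot (F (x + t *: v)) w)
    (edot (v *m 'J F (x + s *: v)) w).
Proof.
move=> dF.
suff h : (fun t : R => t^-1 *: (edot (F (x + (t *: 1 + s) *: v)) w -
      edot (F (x + s *: v)) w)) @ 0^' --> edot (v *m 'J F (x + s *: v)) w.
  split; first by apply/cvg_ex; eexists; exact: h.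
  exact: (cvg_lim _ h).
rewrite -deriveEjacobian// (edotC ('D_v F _)).
have H1 := diff_derivable (v := v) dF.
have H : edot w (h^-1 *: ((F \o shift (x + s *: v)) (h *: v) - F (x + s *: v)))
    @[h --> 0^'] --> edot w ('D_v F (x + s *: v)).
  by apply: (continuous_cvg _ _ H1); exact: edot_continuous.
apply: cvg_trans H.
apply: near_eq_cvg; near=> t => /=.
rewrite edotZr edotBr !(edotC w) /=; congr (_ * (edot (F _) _ - _)).
by rewrite /= scalerDl /GRing.scale /= mulr1 addrC addrA addrAC.
Unshelve. all: by end_near. Qed.

Lemma grad_continuous f : twice_differentiable f -> continuous (grad f).
Proof. by move=> [_ df] x; exact: differentiable_continuous. Qed.

(** The gradient is paired with its own increment w: the mean value theorem then gives |w|^2 = t <u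
    H, w> for a Hessian H on the segment, hence |w| <= t |u H|. *)
Lemma grad_lipschitz_line f L0 L1 x u (t M : R) :
  twice_differentiable f -> L0L1_smooth L0 L1 f -> 0 < L1 ->
  enorm u = 1 -> 0 <= t ->
  (forall s, 0 <= s <= t -> enorm (grad f (x + s *: u)) <= M) ->
  enorm (grad f (x + t *: u) - grad f x) <= t * (L0 + L1 * M).
Proof.
move=> [df ddf] smooth L1gt0 u1 t0 HM; set w := _ - _.
pose psi s := edot (grad f (x + s *: u)) w.
have dpsi (s : R) : is_derive s 1 psi (edot (u *m hessian f (x + s *: u)) w).
  exact: is_derive_edot_line.
have [|c] := MVT_segment t0 (fun s _ => dpsi s).
  by apply: derivable_within_continuous => s _; exact: ex_derive.
rewrite in_itv /= => c0t; rewrite /psi scale0r addr0 -edotBl -enorm_sqr subr0 => E.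
(* For a zero increment the right-hand side must be shown nonnegative; this comes from smoothness at
   [x], since an operator norm is nonnegative. *)
have [->|w0] := eqVneq w 0.
  rewrite enorm0 mulr_ge0//; have := smooth (x + 0 *: u).
  have := HM 0; rewrite lexx t0 => /(_ isT) h1 h2.
  apply: (le_trans _ (_ : L0 + L1 * enorm (grad f (x + 0 *: u)) <= _)).
    apply: le_trans h2; have := enorm_mulmx_le_opnorm (hessian f (x + 0 *: u)) u.
    by rewrite u1 mulr1; apply: le_trans; exact: enorm_ge0.
  by rewrite lerD2l ler_pM2l.
have nw : 0 < enorm w by rewrite lt_neqAle eq_sym enorm_eq0 w0 enorm_ge0.
rewrite -(ler_pM2l nw) -expr2 E mulrC mulrCA ler_wpM2l//.
apply: (le_trans (edot_le_enorm _ _)); rewrite mulrC ler_wpM2l ?enorm_ge0//.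
apply: (le_trans (enorm_mulmx_le_opnorm _ _)); rewrite u1 mulr1.
by apply: (le_trans (smooth _)); rewrite lerD2l ler_pM2l// HM.
Qed.

(* On the segment of length |grad f x| / (3 (L0 + L1 |grad f x|)) <= 1 / (3 L1)
   in the direction of -grad f x, the largest gradient norm M satisfies
   M <= |grad f x| + (L0 + L1 M) / (3 L1), hence the Hessian stays below
   3/2 (L0 + L1 |grad f x|). *)
Lemma grad_sqr_le_gap f L0 L1 x xstar :
  twice_differentiable f -> L0L1_smooth L0 L1 f -> is_convex f ->
  0 < L0 -> 0 < L1 -> (forall y, f xstar <= f y) ->
  enorm (grad f x) ^+ 2 <=
    6 * (L0 + L1 * enorm (grad f x)) * (f x - f xstar).
Proof.
move=> tf smooth cf L0gt0 L1gt0 fmin.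
have [g0|g0] := eqVneq (grad f x) 0.
  by rewrite g0 enorm0 expr0n /= mulr0 addr0 !mulr_ge0 ?(ltW L0gt0) ?subr_ge0.
set g := enorm (grad f x).
have g_gt0 : 0 < g by rewrite lt_neqAle eq_sym enorm_eq0 g0 enorm_ge0.
pose K := L0 + L1 * g; have K0 : 0 < K by rewrite addr_gt0 ?mulr_gt0.
pose u := - (g^-1 *: grad f x).
have u1 : enorm u = 1.
  by rewrite enormN enormZ ger0_norm ?invr_ge0 ?enorm_ge0// mulVf// gt_eqF.
pose t := g / (3 * K).
have t0 : 0 <= t by rewrite divr_ge0 ?mulr_ge0 ?(ltW K0) ?(ltW g_gt0).
have tE : 3 * t * K = g by rewrite /t; field; rewrite gt_eqF.
have line_cont : continuous (fun s : R => enorm (grad f (x + s *: u))).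
  move=> s; apply: (continuous_comp (f := fun s : R => grad f (x + s *: u))).
    apply: (continuous_comp (f := fun s : R => x + s *: u)).
      by apply: cvgD; [exact: cvg_cst|exact: scalel_continuous].
    exact: grad_continuous.
  exact: enorm_continuous.
have [c c0t cmax] := EVT_max t0 (@continuous_subspaceT _ _ `[0, t] _ line_cont).
set M := enorm (grad f (x + c *: u)) in cmax.
have {}cmax s : 0 <= s <= t -> enorm (grad f (x + s *: u)) <= M.
  by move=> h; apply: cmax; rewrite in_itv.
have M0 : 0 <= M := enorm_ge0 _.
move: c0t; rewrite in_itv /= => /andP[c0 ct].
have tL : t * L1 <= 1 / 3.
  rewrite /t mulrAC ler_pdivrMr ?mulr_gt0// /K; nra.
have ML : L0 + L1 * M <= 3 / 2 * K.
  have : M <= g + c * (L0 + L1 * M).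
    have -> : M = enorm (grad f x + (grad f (x + c *: u) - grad f x)).
      by rewrite subrKC.
    rewrite (le_trans (enormD _ _))// lerD2l.
    apply: grad_lipschitz_line => // s /andP[s0 sc].
    by rewrite subrKC cmax// s0 (le_trans sc).
  have cL : c * L1 <= 1 / 3 by rewrite (le_trans _ tL)// ler_pM2r.
  have LM : 0 < L0 + L1 * M by rewrite ltr_wpDr// mulr_ge0// ltW.
  rewrite -(ler_pM2l L1gt0) => h.
  suff : L1 * c * (L0 + L1 * M) <= 1 / 3 * (L0 + L1 * M) by rewrite /K; nra.
  by rewrite ler_pM2r// mulrC.
have Hg : enorm (grad f (x + t *: u) - grad f x) <= t * (3 / 2 * K).
  apply: le_trans (grad_lipschitz_line f L0 L1 x u t M tf smooth L1gt0 u1 t0 cmax) _.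
  by rewrite ler_wpM2l.
have df : differentiable f (x + t *: u) by case: tf => df _; exact: df.
(* Convexity at the end point gives f (x + t u) <= f x + t <grad f (x + t u), u>, so the gradient
   increment alone controls the decrease. The decrease is at least t g - 3/2 K t^2, which t = g / (3
   K) maximizes, with value g^2 / (6 K). *)
have := convex_grad_le f (x + t *: u) x cf df.
have -> : x - (x + t *: u) = - (t *: u) by rewrite opprD addrA subrr add0r.
rewrite edotNr edotZr.
have -> : grad f (x + t *: u) = grad f x + (grad f (x + t *: u) - grad f x).
  by rewrite subrKC.
rewrite edotDl.
have -> : edot (grad f x) u = - g.
  by rewrite edotNr edotZr -enorm_sqr -/g; field; rewrite gt_eqF.
have := edot_le_enorm (grad f (x + t *: u) - grad f x) u.
rewrite u1 mulr1; set e := edot _ u; have := fmin (x + t *: u).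
set F := f (x + t *: u); set N := enorm (_ - _) in Hg *.
move=> h1 h2 h3.
have h4 : t * e <= t * (t * (3 / 2 * K)) by rewrite ler_wpM2l// (le_trans h2).
have h5 : f xstar <= f x - t * g + t * t * (3 / 2 * K) by nra.
have -> : g ^+ 2 = 6 * K * (t * g - t * t * (3 / 2 * K)) by rewrite -tE; field.
by rewrite ler_wpM2l ?mulr_ge0 ?(ltW K0)//; lra.
Qed.

Lemma gap_le_edot_grad f x xstar : is_convex f -> differentiable f x ->
  f x - f xstar <= edot (grad f x) (x - xstar).
Proof.
move=> cf df; have := convex_grad_le f x xstar cf df.
by rewrite -(opprB x) edotNr; lra.
Qed.

(** Jensen's inequality from the tangent plane at the mean, whose linear terms sum to 0. *)
Lemma convex_mean_le f (I : finType) (A : {set I}) (X : I -> 'rV[R]_d) :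
  is_convex f -> (forall x, differentiable f x) -> A != finset.set0 ->
  f (#|A|%:R^-1 *: \sum_(i in A) X i) <= #|A|%:R^-1 * \sum_(i in A) f (X i).
Proof.
move=> cf df A0; set x := _ *: _.
have cA : 0 < #|A|%:R :> R by rewrite ltr0n card_gt0.
rewrite ler_pdivlMl//.
have : \sum_(i in A) (f x + edot (grad f x) (X i - x)) <= \sum_(i in A) f (X i).
  by apply: ler_sum => i _; exact: convex_grad_le.
rewrite big_split /= sumr_const -(mulr_natl (f x)).
suff -> : \sum_(i in A) edot (grad f x) (X i - x) = 0 by rewrite addr0.
rewrite (eq_bigr (fun i => edot (X i - x) (grad f x))) => [|i _]; last exact: edotC.
rewrite -edot_suml sumrB sumr_const -scaler_nat /x scalerA mulfV ?gt_eqF//.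
by rewrite scale1r subrr edot0l.
Qed.

End Smoothness.

(** * Borel measurability of vector-valued maps *)

Section BorelVectors.
Context {R : realType} {d : nat}.

Lemma continuous_measurable_borel_rV (phi : 'rV[R]_d -> R) :
  continuous phi -> measurable_fun setT (phi : borel_rV R d -> R).
Proof.
move=> /continuousP cphi; apply: (measurability _ (RGenOpens.measurableE R)).
move=> _ [_ [a [b ->]] <-]; rewrite setTI; apply: sub_sigma_algebra.
by apply: cphi; exact: interval_open.
Qed.

(** An open set is the countable union of the boxes it contains with rational center and half-width
    1 / (n + 1), and the preimage of a box is a finite intersection of coordinate preimages. *)
Lemma measurable_fun_borel_rV dT (T : measurableType dT) (h : T -> 'rV[R]_d) :
  (forall i, measurable_fun setT (fun t => h t 0 i)) ->
  measurable_fun setT (h : T -> borel_rV R d).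
Proof.
move=> mh; apply: (@measurability _ _ T (borel_rV R d) setT h
  (@open 'rV[R]_d) erefl) => _ [U oU <-]; rewrite setTI.
pose box (p : 'rV[rat]_d * nat) : set 'rV[R]_d :=
  [set y | forall i, `|ratr (p.1 0 i) - y 0 i| < p.2.+1%:R^-1].
pose F p := if `[< box p `<=` U >] then h @^-1` box p else set0.
have -> : h @^-1` U = \bigcup_p F p.
  apply/seteqP; split => [t /= Ut|t [p _]]; last first.
    by rewrite /F; case: asboolP => // pU /pU.
  have /nbhs_ballP[e /= e0 eU] : nbhs (h t) U by exact: open_nbhs_nbhs.
  have [n ne] : exists n : nat, n.+1%:R^-1 < e / 2.
    have e20 : 0 < e / 2 by rewrite divr_gt0.
    exists (Num.truncn (e / 2)^-1).
    by rewrite invf_plt ?posrE ?ltr0n// truncnS_gt.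
  have n0 : 0 < n.+1%:R^-1 :> R by rewrite invr_gt0 ltr0n.
  move Ea : (n.+1%:R^-1) => a in ne n0.
  have /choice[q qh] i : exists q : rat, `|ratr q - h t 0 i| < a.
    have /rat_in_itvoo[q] : h t 0 i - a < h t 0 i + a by lra.
    rewrite in_itv /= => /andP[q1 q2]; exists q.
    by rewrite ltr_norml; apply/andP; split; lra.
  exists (\row_i q i, n) => //; rewrite /F; case: asboolP => [_ i|].
    by rewrite /= mxE Ea; exact: qh.
  case=> y yb; apply: eU; split => // i j; rewrite ord1 /ball /=.
  have := yb j; have := qh j; rewrite /= mxE Ea.
  by rewrite !ltr_norml => /andP[? ?] /andP[? ?]; apply/andP; split; lra.
apply: countable_bigcupT_measurable => // p; rewrite /F.
case: asboolP => // _.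
have -> : h @^-1` box p = \bigcap_i ((fun t => h t 0 i) @^-1`
    [set a | `|ratr (p.1 0 i) - a| < p.2.+1%:R^-1]).
  by apply/seteqP; split => t /= H i; [move=> _; exact: H|exact: (H i I)].
apply: fin_bigcap_measurable => // i _; rewrite -[X in measurable X]setTI.
apply: mh => //; exact: (measurable_ball (ratr (p.1 0 i) : R)).
Qed.

Section Operations.
Context {dT : measure_display} {T : measurableType dT}.
Implicit Types h k : T -> borel_rV R d.

Lemma measurable_coord h i :
  measurable_fun setT h -> measurable_fun setT (fun t => (h t : 'rV[R]_d) 0 i).
Proof.
apply: (measurableT_comp (f := fun x : borel_rV R d => (x : 'rV[R]_d) 0 i)).
by apply: continuous_measurable_borel_rV; exact: coord_continuous.
Qed.

Lemma measurable_rVD h k : measurable_fun setT h -> measurable_fun setT k ->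
  measurable_fun setT (fun t => (h t : 'rV[R]_d) + k t : borel_rV R d).
Proof.
move=> mh mk; apply: measurable_fun_borel_rV => i; under eq_fun do rewrite mxE.
by apply: measurable_funD; exact: measurable_coord.
Qed.

Lemma measurable_rVZ (a : T -> R) h :
  measurable_fun setT a -> measurable_fun setT h ->
  measurable_fun setT (fun t => a t *: (h t : 'rV[R]_d) : borel_rV R d).
Proof.
move=> ma mh; apply: measurable_fun_borel_rV => i; under eq_fun do rewrite mxE.
by apply: measurable_funM => //; exact: measurable_coord.
Qed.

Lemma measurable_rVB h k : measurable_fun setT h -> measurable_fun setT k ->
  measurable_fun setT (fun t => (h t : 'rV[R]_d) - k t : borel_rV R d).
Proof.
move=> mh mk; under eq_fun do rewrite -scaleN1r.
by apply: measurable_rVD => //; exact: measurable_rVZ.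
Qed.

Lemma measurable_edot h k : measurable_fun setT h -> measurable_fun setT k ->
  measurable_fun setT (fun t => edot (h t) (k t)).
Proof.
move=> mh mk; apply: measurable_sum => i.
by apply: measurable_funM; exact: measurable_coord.
Qed.

Lemma measurable_enorm h :
  measurable_fun setT h -> measurable_fun setT (fun t => enorm (h t)).
Proof.
apply: (measurableT_comp (f := fun x : borel_rV R d => enorm x)).
by apply: continuous_measurable_borel_rV; exact: enorm_continuous.
Qed.

Lemma measurable_funV (a : T -> R) : measurable_fun setT a ->
  (forall t, 0 <= a t) -> measurable_fun setT (fun t => (a t)^-1).
Proof.
move=> ma a0.
have -> : (fun t => (a t)^-1) = (@powR R ^~ (-1)) \o a.
  by apply/funext => t /=; rewrite powR_inv1.
exact: (measurableT_comp (@measurable_powR R (-1)) ma).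
Qed.

Lemma measurable_clamp a (x0 : 'rV[R]_d) h : measurable_fun setT h ->
  measurable_fun setT (fun t => clamp a x0 (h t) : borel_rV R d).
Proof.
move=> mh; have mx0 : measurable_fun setT (fun _ : T => x0 : borel_rV R d) by [].
have mn : measurable_fun setT (fun t => enorm ((h t : 'rV[R]_d) - x0)).
  by apply: measurable_enorm; exact: measurable_rVB.
rewrite /clamp; apply: measurable_fun_ifT => //.
  exact: measurable_fun_ler mn (measurable_cst _).
apply: measurable_rVD => //; apply: measurable_rVZ; last exact: measurable_rVB.
apply: measurable_funM => //.
by apply: measurable_funV => // t; exact: enorm_ge0.
Qed.

Lemma measurable_eproj_eball (r : \bar R) (x0 : 'rV[R]_d) h : (0 < r)%E ->
  measurable_fun setT h ->
  measurable_fun setT (fun t => eproj (eball x0 r) (h t) : borel_rV R d).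
Proof.
case: r => [a| |]//.
  rewrite lte_fin => a0 mh; under eq_fun do rewrite eproj_eball//.
  exact: measurable_clamp.
move=> _ mh; have -> : eball x0 +oo%E = setT.
  by apply/seteqP; split => // z _; rewrite /eball /= leey.
by under eq_fun do rewrite eproj_setT.
Qed.

End Operations.
End BorelVectors.

(** * Independence of a fresh seed from the past *)

Section FreshSeeds.
Context {R : realType} {dO dS : measure_display}.
Context {Omega : measurableType dO} {S : measurableType dS}.
Variables (P : probability Omega R) (mu : probability S R).
Variable (xi : nat -> {mfun Omega >-> S}).
Hypothesis xi_iid : iid P mu xi.

Definition cylinder (k : nat) : set (set Omega) :=
  [set E | exists2 A : nat -> set S, (forall i, measurable (A i)) &
     E = \bigcap_(i in `I_k) (xi i @^-1` A i)].

(** [Omega] with the sigma-algebra generated by the seeds of index below k. As a measurable type of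
    its own, it turns adaptedness into [measurable_fun] out of [past k]. *)
Definition past (k : nat) := g_sigma_algebraType (cylinder k).

Lemma measurable_preimage_seed i (A : set S) :
  measurable A -> measurable (xi i @^-1` A).
Proof. by move=> mA; rewrite -[X in measurable X]setTI; exact: measurable_funP. Qed.

Lemma measurable_cylinder k E : cylinder k E -> measurable E.
Proof.
move=> [A mA ->]; apply: fin_bigcap_measurable => // i _.
exact: measurable_preimage_seed.
Qed.

Lemma measurable_past k (E : set (past k)) :
  measurable E -> measurable (E : set Omega).
Proof.
move: E; change (<<s cylinder k >> `<=` @measurable _ Omega).
apply: smallest_sub; first exact: sigma_algebra_measurable.
by move=> F; exact: measurable_cylinder.
Qed.

Lemma cylinder_setI k : setI_closed (cylinder k).
Proof.
move=> _ _ [A mA ->] [B mB ->]; exists (fun i => A i `&` B i).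
  by move=> i; exact: measurableI.
by rewrite -bigcapI; apply: eq_bigcapr => i _; rewrite preimage_setI.
Qed.

Lemma measurable_past_seed k i : (i < k)%N ->
  measurable_fun setT (xi i : past k -> S).
Proof.
move=> ik _ B mB; rewrite setTI; apply: sub_sigma_algebra.
exists (fun j => if j == i then B else setT) => [j|]; first by case: ifP.
apply/seteqP; split => [w Bw j jk /=|w /(_ i ik)]; last by rewrite /= eqxx.
by case: eqP => // ->.
Qed.

Lemma measurable_past_lt k l (E : set Omega) : (k <= l)%N ->
  measurable (E : set (past k)) -> measurable (E : set (past l)).
Proof.
move=> kl; move: E; change (<<s cylinder k >> `<=` @measurable _ (past l)).
apply: smallest_sub; first exact: (@sigma_algebra_measurable _ (past l)).
move=> _ [A mA ->]; apply: fin_bigcap_measurable => // i ik.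
rewrite -[X in measurable X]setTI; apply: (measurable_past_seed l i) => //.
exact: leq_trans kl.
Qed.

Lemma measurable_fun_past_lt k l d (T : measurableType d) (h : Omega -> T) :
  (k <= l)%N -> measurable_fun setT (h : past k -> T) ->
  measurable_fun setT (h : past l -> T).
Proof.
by move=> kl mh _ B mB; apply: (measurable_past_lt k l) => //; exact: mh.
Qed.

Lemma measurable_fun_past k d (T : measurableType d) (h : Omega -> T) :
  measurable_fun setT (h : past k -> T) -> measurable_fun setT h.
Proof. by move=> mh _ B mB; apply: (measurable_past k); exact: mh. Qed.

(** Mutual independence is used twice, for the indices below k and for these together with k; the
    family [A'] carries [B] at index k. *)
Lemma cylinder_seed_indep k E (B : set S) : cylinder k E -> measurable B ->
  (P (E `&` xi k @^-1` B) = P E * mu B)%E.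
Proof.
move=> [A mA ->] mB; case: xi_iid => law indep.
pose J := fset_set `I_k.
have JE : [set` J] = `I_k by rewrite /J fset_setK.
have kJ : k \notin J.
  by apply/negP => kJ; have : [set` J] k by []; rewrite JE /= ltnn.
pose A' i := if i == k then B else A i.
have mA' i : measurable (A' i) by rewrite /A'; case: ifP.
have := indep (k |` J)%fset A' mA'.
have A'k : A' k = B by rewrite /A' eqxx.
rewrite big_fsetU1//= A'k.
have -> : P (xi k @^-1` B) = mu B by rewrite -(law k B mB).
have AJ i : i \in J -> A' i = A i.
  by rewrite /A'; case: eqP => // -> /negPn; rewrite kJ.
have -> : (\prod_(i <- J) P (xi i @^-1` A' i) = \prod_(i <- J) P (xi i @^-1` A i))%E.
  by apply: eq_fbigr => i iJ _; rewrite AJ.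
rewrite -(indep J A mA) JE muleC => <-; congr (P _).
rewrite set_fsetU1 bigcap_setU1 JE A'k setIC; congr (_ `&` _).
by apply: eq_bigcapr => i; rewrite /A' /=; case: eqP => // ->; rewrite ltnn.
Qed.

(** Dynkin's argument: cylinders are stable under intersection, and the product formula survives
    complements and countable disjoint unions. *)
Lemma past_seed_indep k (E : set (past k)) (B : set S) :
  measurable E -> measurable B -> (P (E `&` xi k @^-1` B) = P E * mu B)%E.
Proof.
move=> mE mB; move: E mE.
have mxB := measurable_preimage_seed k B mB.
have finmB : mu B \is a fin_num by rewrite fin_num_measure.
apply: (@dynkin_induction _ (past k) (cylinder k)
  [set E | P (E `&` xi k @^-1` B) = P E * mu B]%E) => //=.
- exact: cylinder_setI.
- rewrite setTI probability_setT mul1e -((proj1 xi_iid) k B mB).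
  by [].
- by move=> E cE; exact: cylinder_seed_indep.
- move=> E /(measurable_past k) mE EB.
  have PXB : P (xi k @^-1` B) = mu B by rewrite -((proj1 xi_iid) k B mB).
  rewrite setIC -setDE measureD//; last by rewrite -ge0_fin_numE// fin_num_measure.
  transitivity (mu B - P E * mu B)%E.
    by congr (_ - _)%E; [exact: PXB|rewrite setIC; exact: EB].
  by rewrite probability_setC// muleBl ?mul1e.
- move=> F mF tF FB.
  have mF' n : measurable (F n : set Omega) by exact: (measurable_past k).
  rewrite setI_bigcupl !measure_bigcup//; last 2 first.
    by move=> n _; exact: measurableI.
    by apply: trivIset_setIr.
  rewrite -(fineK finmB) muleC -nneseriesZl; last by move=> *; exact: measure_ge0.
  by apply: eq_eseriesr => n _; rewrite fineK// muleC; exact: FB.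
Qed.

(** This is conditioning on the past in elementary form: the joint law of the past and seed k is a
    product measure, so Tonelli integrates out the fresh seed first. *)
Lemma integral_fresh_seed k (h : past k * S -> \bar R) :
  measurable_fun setT h -> (forall p, 0 <= h p)%E ->
  (\int[P]_w h (w, xi k w) = \int[P]_w \int[mu]_s h (w, s))%E.
Proof.
move=> mh h0.
have mid : measurable_fun setT (id : Omega -> past k).
  by apply: measurable_fun_past; exact: measurable_id.
have mphi : measurable_fun setT (fun w : Omega => (w : past k, xi k w)).
  by apply: measurable_fun_pair.
(* The identity into the coarser space; its law is the restriction of [P] to the past. *)
pose idk : {mfun Omega >-> past k} := HB.pack (id : Omega -> past k)
  (isMeasurableFun.Build _ _ _ _ _ mid).
pose phi : {mfun Omega >-> (past k * S)%type} :=
  HB.pack (fun w : Omega => (w : past k, xi k w))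
  (isMeasurableFun.Build _ _ _ _ _ mphi).
have joint : forall X : set (past k * S), measurable X ->
    (distribution P idk \x mu)%E X = distribution P phi X.
  apply: product_measure_unique => A B mA mB.
  exact: past_seed_indep.
have -> : (\int[P]_w h (w, xi k w) = \int[distribution P phi]_p h p)%E.
  by rewrite ge0_integral_pushforward.
rewrite -(eq_measure_integral _ (fun A mA _ => joint A mA)).
rewrite fubini_tonelli1//= ge0_integral_pushforward//.
  exact: measurable_fun_fubini_tonelli_F.
by move=> w _; exact: integral_ge0.
Qed.

End FreshSeeds.

(** * Moment generating function of a subgaussian vector *)

Section Subgaussian.
Context {R : realType}.

(** Made for centered variables: the linear term vanishes in the mean. For x <= 1, squaring exp
    (x/2) (1 - x/2) <= 1 reduces the claim to a polynomial inequality. *)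
Lemma expR_le_add (x : R) : expR x <= x + expR (2 * x ^+ 2).
Proof.
have [x1|x1] := ltP 1 x.
  apply: (@le_trans _ _ (expR (2 * x ^+ 2))); last by rewrite lerDr; lra.
  by rewrite ler_expR; nra.
apply: (@le_trans _ _ (x + (1 + 2 * x ^+ 2))); last by rewrite lerD2l expR_ge1Dx.
have h1 : expR (x / 2) * (1 - x / 2) <= 1.
  rewrite -[leRHS](expRxMexpNx_1 (x / 2)) ler_wpM2l ?expR_ge0//.
  exact: expR_ge1Dx.
have -> : expR x = expR (x / 2) ^+ 2 by rewrite -expRM_natl mulrC divfK.
set e := expR _ in h1 *; have e0 : 0 < e := expR_gt0 _.
have h2 : (e * (1 - x / 2)) ^+ 2 <= 1.
  by rewrite -[leRHS](expr1n _ 2) ler_pXn2r ?nnegrE ?mulr_ge0//; lra.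
have h3 : 1 <= (1 + x + 2 * x ^+ 2) * (1 - x / 2) ^+ 2.
  have -> : (1 + x + 2 * x ^+ 2) * (1 - x / 2) ^+ 2 =
            1 + x ^+ 2 * ((1 - x) * (5 / 2 - x)) / 2 by field.
  by rewrite lerDl divr_ge0// mulr_ge0 ?sqr_ge0// mulr_ge0//; lra.
have h4 : 0 < (1 - x / 2) ^+ 2 by rewrite exprn_gt0//; lra.
rewrite -(ler_pM2r h4) -exprMn (le_trans h2)// (le_trans h3)//.
by rewrite ler_pM2r//; lra.
Qed.

(** Convexity of exp on the chord from 0 to z, obtained by weighting the tangent at p z evaluated at
    both ends. *)
Lemma expR_mul_le (p z : R) : 0 <= p -> p <= 1 -> expR (p * z) <= 1 - p + p * expR z.
Proof.
move=> p0 p1; set E := expR (p * z); have E0 : 0 < E := expR_gt0 _.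
have h1 : E * (1 + (1 - p) * z) <= expR z.
  have -> : expR z = E * expR ((1 - p) * z) by rewrite -expRD; congr expR; ring.
  by rewrite ler_pM2l// expR_ge1Dx.
have h2 : E * (1 - p * z) <= 1.
  by rewrite -[leRHS](expRxMexpNx_1 (p * z)) ler_pM2l// expR_ge1Dx.
have h3 : p * (E * (1 + (1 - p) * z)) <= p * expR z by rewrite ler_wpM2l.
have h4 : (1 - p) * (E * (1 - p * z)) <= (1 - p) * 1 by rewrite ler_wpM2l//; lra.
by lra.
Qed.

Context {dS : measure_display} {S : measurableType dS} {d : nat}.
Variables (mu : probability S R) (n : S -> borel_rV R d) (sigma : R).
Hypothesis sigma0 : 0 < sigma.
Hypothesis mn : measurable_fun setT n.

Let z s := enorm (n s) ^+ 2 / sigma ^+ 2.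

Hypothesis n_exp : (\int[mu]_s (expR (z s))%:E <= (expR 1)%:E)%E.

Let mz : measurable_fun setT z.
Proof.
apply: measurable_funM => //; apply: measurable_funX.
exact: measurable_enorm.
Qed.

Let mexpz : measurable_fun setT (fun s => (expR (z s))%:E).
Proof. by apply/measurable_EFinP; exact: measurableT_comp. Qed.

Let int_expz : mu.-integrable setT (fun s => (expR (z s))%:E).
Proof.
apply/integrableP; split => //.
under eq_integral do rewrite gee0_abs ?lee_fin ?expR_ge0//.
exact: le_lt_trans n_exp (ltry _).
Qed.

(** Jensen's inequality for the p-th power. The chord bound is applied to z - 1, so that it loses
    nothing when the exponential moment equals exp 1. *)
Lemma integral_expR_mul_le p : 0 <= p -> p <= 1 ->
  (\int[mu]_s (expR (p * z s))%:E <= (expR p)%:E)%E.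
Proof.
move=> p0 p1.
pose A := expR p * (1 - p); pose B := expR p * p * expR (- 1).
have A0 : 0 <= A by rewrite mulr_ge0 ?expR_ge0// subr_ge0.
have B0 : 0 <= B by rewrite !mulr_ge0 ?expR_ge0.
apply: (@le_trans _ _ (\int[mu]_s (A%:E + B%:E * (expR (z s))%:E))%E).
  apply: ge0_le_integral => //.
  - by apply/measurable_EFinP; apply: measurableT_comp => //; exact: measurable_funM.
  - by apply: emeasurable_funD => //; exact: measurable_funeM.
  - move=> s _; rewrite lee_fin.
    have -> : p * z s = p + p * (z s - 1) by ring.
    rewrite expRD /A /B -!mulrA -mulrDr ler_wpM2l ?expR_ge0// -expRD.
    by rewrite (addrC (-1)); exact: expR_mul_le.
rewrite ge0_integralD//; last 2 first.
- by move=> s _; rewrite mule_ge0 ?lee_fin ?expR_ge0.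
- exact: measurable_funeM.
rewrite integral_cst// ge0_integralZl//.
apply: (@le_trans _ _ (A%:E * mu setT + B%:E * (expR 1)%:E)%E).
  by rewrite leeD2l// lee_wpmul2l// lee_fin.
rewrite probability_setT mule1 lee_fin /A /B.
have E1 := expRxMexpNx_1 (1 : R).
have -> : expR p * (1 - p) + expR p * p * expR (-1) * expR 1 =
  expR p * (1 - p + p * (expR 1 * expR (-1))) by ring.
by rewrite E1; lra.
Qed.

Lemma subgaussian_integrable i : mu.-integrable setT (fun s => (n s 0 i)%:E).
Proof.
apply: (le_integrable measurableT _ _ (integrableZl measurableT sigma int_expz)).
  by apply/measurable_EFinP; exact: measurable_coord.
move=> s _; rewrite lee_fin (le_trans (normr_le_enorm _ _))//.
rewrite ger0_norm ?mulr_ge0 ?expR_ge0 ?(ltW sigma0)//.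
rewrite -ler_pdivrMl// (le_trans _ (expR_ge1Dx _))//.
have -> : z s = (sigma^-1 * enorm (n s)) ^+ 2 by rewrite exprMn exprVn mulrC.
by have := sqr_ge0 (sigma^-1 * enorm (n s) - 1); rewrite sqrrB; nra.
Qed.

Hypothesis n_mean : forall i, (\int[mu]_s (n s 0 i)%:E = 0)%E.

Let integral_edot v : (\int[mu]_s (edot v (n s))%:E = 0)%E.
Proof.
have int_n := subgaussian_integrable.
under eq_integral do rewrite -sumEFin; rewrite integral_sum//.
  apply: big1 => i _; under eq_integral do rewrite EFinM.
  by rewrite integralZl// n_mean mule0.
by move=> i; under eq_fun do rewrite EFinM; exact: integrableZl.
Qed.

Let int_edot v : mu.-integrable setT (fun s => (edot v (n s))%:E).
Proof.
have int_n := subgaussian_integrable.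
under eq_fun do rewrite -sumEFin; apply: integrable_sum => // i _.
by under eq_fun do rewrite EFinM; exact: integrableZl.
Qed.

(** Two regimes for a = |v|^2 sigma^2. If 2 a > 1, then <v, n> <= a / 2 + z / 2 and (a + 1) / 2 <= 2
    a. If 2 a <= 1, [expR_le_add] leaves exp (2 a z) after the mean vanishes, and 2 a is an
    admissible power. *)
Lemma subgaussian_mgf v :
  (\int[mu]_s (expR (edot v (n s)))%:E <=
    (expR (2 * (enorm v ^+ 2 * sigma ^+ 2)))%:E)%E.
Proof.
set a := _ * sigma ^+ 2.
have a0 : 0 <= a by rewrite mulr_ge0 ?sqr_ge0.
have az s : enorm v ^+ 2 * enorm (n s) ^+ 2 = a * z s.
  by rewrite /a /z; field; rewrite gt_eqF.
have mexp : measurable_fun setT (fun s => (expR (edot v (n s)))%:E).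
  apply/measurable_EFinP; apply: measurableT_comp => //.
  exact: measurable_edot.
have mexpz' p : measurable_fun setT (fun s => (expR (p * z s))%:E).
  by apply/measurable_EFinP; apply: measurableT_comp => //; exact: measurable_funM.
have [a2|/ltW a2] := leP (2 * a) 1; last first.
  apply: (@le_trans _ _ (\int[mu]_s ((expR (a / 2))%:E * (expR (1 / 2 * z s))%:E))%E).
    apply: ge0_le_integral => //.
    - exact: measurable_funeM.
    - move=> s _; rewrite lee_fin -expRD ler_expR (le_trans (edot_le_enorm _ _))//.
      have -> : enorm v * enorm (n s) = (enorm v * sigma) * (enorm (n s) / sigma).
        by field; rewrite gt_eqF.
      rewrite /a /z -exprMn -expr_div_n.
      by have := sqr_ge0 (enorm v * sigma - enorm (n s) / sigma); rewrite sqrrB; lra.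
  rewrite ge0_integralZl//.
  apply: (@le_trans _ _ ((expR (a / 2))%:E * (expR (1 / 2))%:E)%E).
    by rewrite lee_wpmul2l ?lee_fin ?expR_ge0// integral_expR_mul_le//; lra.
  by rewrite lee_fin -expRD ler_expR; lra.
have int_expaz : mu.-integrable setT (fun s => (expR (2 * a * z s))%:E).
  apply/integrableP; split => //.
  under eq_integral do rewrite gee0_abs ?lee_fin ?expR_ge0//.
  by apply: le_lt_trans (integral_expR_mul_le _ _ a2) (ltry _); lra.
apply: (@le_trans _ _ (\int[mu]_s ((edot v (n s))%:E + (expR (2 * a * z s))%:E))%E).
  have le s : expR (edot v (n s)) <= edot v (n s) + expR (2 * a * z s).
    rewrite (le_trans (expR_le_add _))// lerD2l ler_expR -mulrA -az.
    rewrite -exprMn ler_pM2l// -[leLHS]real_normK ?num_real//.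
    by rewrite ler_pXn2r ?nnegrE ?mulr_ge0 ?enorm_ge0 ?normr_edot.
  apply: ge0_le_integral => //.
  - apply: emeasurable_funD => //.
    by apply/measurable_EFinP; exact: measurable_edot.
  - by move=> s _; rewrite lee_fin; exact: le.
rewrite integralD// integral_edot add0e.
by apply: integral_expR_mul_le => //; lra.
Qed.

End Subgaussian.

(** * Step size inequalities shared by the three methods *)

Section StepSizes.
Context {R : realType} {d : nat}.
Variables (m : clipping_method) (L0 L1 R0 sigma' delta : R) (T : nat).
Hypotheses (L0_gt0 : 0 < L0) (L1_gt0 : 0 < L1) (R0_gt0 : 0 < R0).
Hypotheses (sigma'_ge0 : 0 <= sigma') (T_gt0 : (0 < T)%N).
Hypothesis log_ge2 : 2 <= log_plus (T%:R / delta).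
Hypothesis T_large : log_plus (T%:R / delta) * (64 * L1 * R0) ^+ 2 <= T%:R.
Implicit Types v : 'rV[R]_d.

Local Notation c := (clip_threshold m L0 L1 R0 sigma' delta T).
Local Notation step v :=
  (step_size m L0 L1 R0 sigma' T v * clip_factor m L0 L1 R0 sigma' delta T v).

Let A := sigma' * Num.sqrt T%:R / R0.
Let B := Num.max (10 * L0) A.

Let sqrtT_gt0 : 0 < Num.sqrt T%:R :> R.
Proof. by rewrite sqrtr_gt0 ltr0n. Qed.

Let sqrtT_sqr : Num.sqrt T%:R ^+ 2 = T%:R :> R.
Proof. by rewrite sqr_sqrtr// ler0n. Qed.

Let A_ge0 : 0 <= A.
Proof. by rewrite divr_ge0 ?mulr_ge0 ?sqrtr_ge0// ltW. Qed.

Let B_bounds : [/\ 0 < B, 10 * L0 <= B, A <= B & B = 10 * L0 \/ B = A].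
Proof.
rewrite /B; split; last by case: (leP (10 * L0) A); [right|left].
- by rewrite lt_max mulr_gt0.
- by rewrite le_max lexx.
- by rewrite le_max lexx orbT.
Qed.

(* The three thresholds only enter through the ratio kappa = c / B. *)
Let threshold_ratio : exists kappa : R,
  [/\ 0 < kappa, c = kappa * B, L1 * kappa <= 1,
      8192 * R0 ^+ 2 <= T%:R * kappa ^+ 2 & 64 * sigma' <= c].
Proof.
(* 8192 is 2 * 64^2, where 2 bounds [log_plus] from below. It yields 64 R0 <= sqrt T kappa, and
   [A <= B] turns this into 64 sigma' <= c. *)
suff [kappa [k0 ck Lk Tk]] : exists kappa : R, [/\ 0 < kappa, c = kappa * B,
    L1 * kappa <= 1 & 8192 * R0 ^+ 2 <= T%:R * kappa ^+ 2].
  exists kappa; split=> //; rewrite ck.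
  have [_ _ AB _] := B_bounds.
  apply: (@le_trans _ _ (kappa * A)); last by rewrite ler_pM2l.
  have sk : 64 * R0 <= Num.sqrt T%:R * kappa.
    rewrite -(@ler_pXn2r _ 2)// ?nnegrE ?mulr_ge0 ?(ltW R0_gt0) ?sqrtr_ge0 ?(ltW k0)//.
    by rewrite !exprMn sqrtT_sqr (le_trans _ Tk)// ler_wpM2r ?sqr_ge0//; lra.
  rewrite /A mulrA ler_pdivlMr// mulrAC.
  have -> : kappa * (sigma' * Num.sqrt T%:R) = sigma' * (Num.sqrt T%:R * kappa) by ring.
  by rewrite mulrC ler_wpM2l.
have BE : Num.max (10 * L0) (Num.sqrt T%:R / R0 * sigma') = B.
  by rewrite /B /A; congr (Num.max _ _); rewrite mulrC mulrA.
have ratio_L1 : exists kappa : R, [/\ 0 < kappa, L1^-1 * B = kappa * B,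
    L1 * kappa <= 1 & 8192 * R0 ^+ 2 <= T%:R * kappa ^+ 2].
  exists L1^-1; rewrite invr_gt0 L1_gt0 mulfV ?gt_eqF// lexx exprVn; split=> //.
  rewrite ler_pdivlMr ?exprn_gt0// (le_trans _ T_large)//.
  have -> : 8192 * R0 ^+ 2 * L1 ^+ 2 = 2 * (64 * L1 * R0) ^+ 2 by ring.
  by rewrite ler_wpM2r ?sqr_ge0.
rewrite /clip_threshold BE; case: m => //.
have := T_large; have := log_ge2; set l := log_plus _ => l2 Tl.
have l_ge0 : 0 <= l by lra.
have sqrtl_sqr : Num.sqrt l ^+ 2 = l by rewrite sqr_sqrtr.
exists (64 * Num.sqrt l * (R0 / Num.sqrt T%:R)); split=> //.
- by rewrite !mulr_gt0 ?invr_gt0// sqrtr_gt0; lra.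
- rewrite mulrA mulrA ler_pdivrMr// mul1r.
  rewrite -(@ler_pXn2r _ 2)// ?nnegrE ?mulr_ge0 ?sqrtr_ge0 ?(ltW L1_gt0) ?(ltW R0_gt0)//.
  rewrite sqrtT_sqr (le_trans _ Tl)// -[X in _ <= X * _]sqrtl_sqr.
  by rewrite le_eqVlt; apply/orP; left; apply/eqP; ring.
- have -> : T%:R * (64 * Num.sqrt l * (R0 / Num.sqrt T%:R)) ^+ 2 = 4096 * l * R0 ^+ 2.
    rewrite !exprMn exprVn sqrtl_sqr sqrtT_sqr; field.
    by rewrite pnatr_eq0 -lt0n.
  by rewrite ler_wpM2r ?sqr_ge0//; lra.
Qed.

Let eta_bounds : let eta := 16^-1 * Num.min (11 * L0)^-1 (L0 + A)^-1 in
  0 < eta /\ [/\ eta * L0 <= 1 / 176, eta * (L0 + A) <= 1 / 16, eta * B <= 1 / 16,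
      1 <= 88 / 5 * eta * B & 1 <= 16 * (11 * L0 + A) * eta].
Proof.
move=> eta; have [B0 LB AB BE] := B_bounds.
have [L0p Ap] := (L0_gt0, A_ge0).
have L0A : 0 < L0 + A by rewrite ltr_wpDr.
have h1 : eta * L0 <= 1 / 176.
  apply: (@le_trans _ _ (16^-1 * (11 * L0)^-1 * L0)).
    by rewrite ler_pM2r// ler_pM2l// ge_min lexx.
  by rewrite le_eqVlt; apply/orP; left; apply/eqP; field; rewrite gt_eqF.
have h2 : eta * (L0 + A) <= 1 / 16.
  apply: (@le_trans _ _ (16^-1 * (L0 + A)^-1 * (L0 + A))).
    by rewrite ler_pM2r// ler_pM2l// ge_min lexx orbT.
  by rewrite le_eqVlt; apply/orP; left; apply/eqP; field; rewrite gt_eqF.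
have eta0 : 0 < eta by rewrite mulr_gt0// lt_min !invr_gt0 L0A mulr_gt0.
have h3 K : 0 < K -> 11 * L0 <= K -> L0 + A <= K -> 1 <= 16 * eta * K.
  move=> K0 K1 K2; rewrite /eta mulrA mulfV// mul1r -ler_pdivrMr// mul1r.
  by rewrite le_min !lef_pV2 ?posrE ?K1 ?K2 ?mulr_gt0.
split=> //; split=> //.
- case: BE => ->; first lra.
  by rewrite (le_trans _ h2)// ler_pM2l// lerDr ltW.
(* Both 11 L0 and L0 + A are at most 11/10 B, and 88/5 = 16 * 11/10. *)
- have : 1 <= 16 * eta * (11 / 10 * B) by apply: h3; lra.
  by lra.
- have : 1 <= 16 * eta * (11 * L0 + A).
    by apply: h3; lra.
  by lra.
Qed.

Let clip_bounds v : let q := enorm v in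
  m <> ImplicitClipping ->
  let alpha := clip_factor m L0 L1 R0 sigma' delta T v in
  [/\ 0 < alpha, alpha <= 1, alpha * q <= c, (q < c -> alpha = 1) &
      (c <= q -> alpha * q = c)].
Proof.
move=> q mI.
have c0 : 0 < c.
  by have [k [k0 -> _ _ _]] := threshold_ratio; have [B0 _ _ _] := B_bounds;
    rewrite mulr_gt0.
have -> : clip_factor m L0 L1 R0 sigma' delta T v =
  if v == 0 then 1 else Num.min 1 (c / enorm v) by case: m mI.
rewrite -/q -enorm_eq0 -/q; case: eqP => [->|/eqP q0] /=.
  by rewrite mulr0 ltr01 lexx (ltW c0); split => //; rewrite leNgt c0.
have {}q0 : 0 < q by rewrite lt_neqAle eq_sym q0 enorm_ge0.
have cq : 0 < c / q by rewrite divr_gt0.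
split.
- by rewrite lt_min ltr01.
- by rewrite ge_min lexx.
- by rewrite -ler_pdivlMr// ge_min lexx orbT.
- by move=> qc; apply/min_idPl; rewrite ler_pdivlMr// mul1r ltW.
- move=> cqq; rewrite (min_idPr _) ?divfK ?gt_eqF//.
  by rewrite ler_pdivrMr// mul1r.
Qed.

(** [q] is the norm of the clipping query, [g] that of the true gradient, [D] the gap. These five
    inequalities are all that the analysis of a run takes from the methods. *)
Lemma step_bounds v : let q := enorm v in
  [/\ 0 < step v, step v * A <= 1 / 8,
      (forall g : R, 0 <= g -> `|q - g| <= sigma' -> step v * (L0 + L1 * g) <= 1 / 8),
      (q < c -> 1 <= 16 * (11 * L0 + 2 * A) * step v) &
      (forall g D : R, 0 <= g -> c <= q -> `|q - g| <= sigma' ->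
         g ^+ 2 <= 6 * (L0 + L1 * g) * D -> 16 * R0 ^+ 2 <= T%:R * (step v * D))].
Proof.
move=> q; have [kappa [k0 ck Lk Tk sc]] := threshold_ratio.
have [[[L0p Ap] sp] l2] := (L0_gt0, A_ge0, sigma'_ge0, log_ge2).
have [B0 LB AB BE] := B_bounds; have q0 : 0 <= q := enorm_ge0 v.
have Lc : L1 * c <= B by rewrite ck mulrA ler_piMl// ltW.
have c0 : 0 < c by rewrite ck mulr_gt0.
(* 512 = 8192 / 16: the progress of a clipped step reduces to a comparison with kappa^2. *)
have gain (a : R) : kappa ^+ 2 <= 512 * a -> 16 * R0 ^+ 2 <= T%:R * a.
  move=> ka; have : T%:R * kappa ^+ 2 <= T%:R * (512 * a) by rewrite ler_wpM2l ?ler0n.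
  by move=> h; have := le_trans Tk h; lra.
clear Tk.
(* A large gradient forces a large gap: with c' = 63/64 c <= g, the bounds L0 <= B / 10 and L1 c <=
   B give c' (L0 + L1 g) <= 11/10 B g, and 33/5 = 6 * 11/10. *)
have key (g D : R) : 0 <= g -> c <= q -> `|q - g| <= sigma' ->
    g ^+ 2 <= 6 * (L0 + L1 * g) * D ->
    [/\ 0 <= D, 63 / 64 * q <= g & 63 / 64 * c * g <= 33 / 5 * B * D].
  move=> g0 cq; rewrite ler_norml => /andP[h1 h2] gD.
  have gq : 63 / 64 * q <= g by lra.
  have g_gt0 : 0 < g by lra.
  have K0 : 0 < L0 + L1 * g by rewrite addr_gt0 ?mulr_gt0.
  have D0 : 0 <= D.
    rewrite leNgt; apply/negP => D0.
    have := le_lt_trans gD (_ : _ < 0); rewrite pmulr_rlt0 ?mulr_gt0// => /(_ D0).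
    by rewrite ltNge sqr_ge0.
  split => //; pose c' := 63 / 64 * c.
  have c'g : c' <= g by rewrite /c'; lra.
  have cK : c' * (L0 + L1 * g) <= 11 / 10 * B * g.
    have : c' * L0 <= g * L0 by rewrite ler_pM2r.
    have : L1 * c * g <= B * g by rewrite ler_pM2r.
    have : 10 * L0 * g <= B * g by rewrite ler_pM2r.
    have : 0 <= L1 * c * g by rewrite !mulr_ge0// ltW.
    rewrite /c'; nra.
  have h3 : c' * g ^+ 2 <= c' * (6 * (L0 + L1 * g) * D).
    by rewrite ler_wpM2l// /c'; lra.
  have h4 : c' * (L0 + L1 * g) * D <= 11 / 10 * B * g * D by rewrite ler_wpM2r.
  by rewrite -(ler_pM2r g_gt0) -/c'; nra.
have [mI|mI] : m = ImplicitClipping \/ m <> ImplicitClipping.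
  by case: m; [right|left|right].
- have -> : step v = 8^-1 * (L0 + q * L1 + A)^-1.
    by rewrite /step_size /clip_factor mI mulr1.
  set K := L0 + q * L1 + A.
  have qL : 0 <= q * L1 by rewrite mulr_ge0// ltW.
  have K0 : 0 < K by rewrite /K; lra.
  set s := 8^-1 * K^-1.
  have sK : s * K = 1 / 8 by rewrite /s; field; rewrite gt_eqF.
  have s0 : 0 < s by rewrite mulr_gt0 ?invr_gt0.
  have le8 (a : R) : a <= K -> s * a <= 1 / 8 by rewrite -sK ler_pM2l.
  (* The term A in the denominator absorbs the error made by using L1 q in place of L1 g. *)
  have Lsigma : L1 * sigma' <= A.
    have skT : R0 * L1 <= Num.sqrt T%:R.
      rewrite -(@ler_pXn2r _ 2)// ?nnegrE ?mulr_ge0 ?sqrtr_ge0 ?(ltW L1_gt0) ?(ltW R0_gt0)//.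
      rewrite sqrtT_sqr (le_trans _ T_large)//.
      have -> : (64 * L1 * R0) ^+ 2 = 4096 * (R0 * L1) ^+ 2 by ring.
      rewrite mulrA ler_peMl ?sqr_ge0//; lra.
    rewrite /A ler_pdivlMr//; have -> : L1 * sigma' * R0 = sigma' * (R0 * L1) by ring.
    by rewrite ler_wpM2l.
  split => //.
  + by apply: le8; rewrite /K; lra.
  + move=> g g0; rewrite ler_norml => /andP[h1 h2]; apply: le8; rewrite /K.
    have : L1 * g <= L1 * (q + sigma').
      by rewrite ler_pM2l//; lra.
    by lra.
  + move=> qc; have qLB : L1 * q <= B.
      by apply: le_trans Lc; rewrite ler_pM2l//; exact: ltW qc.
    (* K <= L0 + B + A, where B is either 10 L0 or A; hence 11 L0 + 2 A. *)
    have KB : K <= 11 * L0 + 2 * A by rewrite /K; case: BE; lra.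
    have : s * K <= s * (11 * L0 + 2 * A) by rewrite ler_pM2l.
    by rewrite sK; lra.
  + move=> g D g0 cq hg gD; apply: gain.
    have [D0 gq cg] := key g D g0 cq hg gD.
    have cE : L1 * c = B.
      rewrite /clip_threshold mI mulrA mulfV ?gt_eqF// mul1r /B /A.
      by congr (Num.max _ _); rewrite mulrC mulrA.
    have {}cg : 63 / 64 * g <= 33 / 5 * (L1 * D).
      rewrite -(ler_pM2l B0).
      have -> : B * (63 / 64 * g) = L1 * (63 / 64 * c * g) by rewrite -cE; ring.
      have -> : B * (33 / 5 * (L1 * D)) = L1 * (33 / 5 * B * D) by ring.
      by rewrite ler_pM2l.
    have Xq : B <= L1 * q by rewrite -cE ler_pM2l.
    have KX : K <= 21 / 10 * (L1 * q) by rewrite /K; lra.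
    have sX : 1 / 8 <= 21 / 10 * (L1 * (s * q)).
      by rewrite -sK (le_trans (_ : _ <= s * (21 / 10 * (L1 * q))))// ?ler_pM2l//; lra.
    have h3 : s * q <= s * (512 / 75 * (L1 * D)) by rewrite ler_pM2l//; lra.
    have h4 : L1 * (s * q) <= L1 * (s * (512 / 75 * (L1 * D))) by rewrite ler_pM2l.
    rewrite -(@ler_pM2l _ (L1 ^+ 2)) ?exprn_gt0// -exprMn.
    apply: (@le_trans _ _ 1); last by lra.
    by rewrite -[leRHS](expr1n _ 2) ler_pXn2r ?nnegrE ?mulr_ge0 ?(ltW L1_gt0) ?(ltW k0).
have [a0 a1 aqc aq1 aqc'] := clip_bounds v mI.
have -> : step_size m L0 L1 R0 sigma' T v = 16^-1 * Num.min (11 * L0)^-1 (L0 + A)^-1.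
  by case: m mI.
have [e0 [eL eLA eB eB1 eLA1]] := eta_bounds.
set e := 16^-1 * _ in e0 eL eLA eB eB1 eLA1 *.
set a := clip_factor _ _ _ _ _ _ _ _ in a0 a1 aqc aq1 aqc' *.
have ae : e * a <= e by rewrite ler_piMr// ltW.
split.
- exact: mulr_gt0.
- have : e * a * A <= e * A by rewrite ler_wpM2r.
  have : e * A <= e * (L0 + A) by rewrite ler_pM2l// lerDr ltW.
  by lra.
- move=> g g0; rewrite ler_norml => /andP[h1 h2].
  have : e * a * L0 <= e * L0 by rewrite ler_wpM2r// ltW.
  have ag : a * g <= 65 / 64 * c.
    have : a * g <= a * (q + c / 64) by rewrite ler_pM2l//; lra.
    have : a * c <= c by rewrite ler_piMl// ltW.
    by rewrite -/q in aqc; lra.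
  have h3 : e * (L1 * (a * g)) <= e * (L1 * (65 / 64 * c)) by rewrite !ler_pM2l.
  have : e * (L1 * c) <= e * B by rewrite ler_pM2l.
  have -> : e * a * (L0 + L1 * g) = e * a * L0 + e * (L1 * (a * g)) by ring.
  have E : e * (L1 * (65 / 64 * c)) = 65 / 64 * (e * (L1 * c)) by ring.
  by rewrite E in h3; move: h3 eB eL; lra.
- move=> qc; rewrite aq1// mulr1.
  have : (11 * L0 + A) * e <= (11 * L0 + 2 * A) * e by rewrite ler_pM2r//; lra.
  by lra.
- move=> g D g0 cq hg gD; apply: gain; have [D0 gq cg] := key g D g0 cq hg gD.
  have h1 : e * a * (63 / 64 * c * g) <= e * a * (33 / 5 * B * D).
    by apply: ler_wpM2l => //; exact: ltW (mulr_gt0 e0 a0).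
  have h2 : e * a * (c * (63 / 64 * q)) <= e * a * (c * g).
    apply: ler_wpM2l; first exact: ltW (mulr_gt0 e0 a0).
    by apply: ler_wpM2l => //; exact: ltW.
  (* Clipping makes a q exactly c, so e a c q = e c^2 = (e B) kappa^2 B, and e B >= 5/88. *)
  have aqE : a * q = c by exact: aqc'.
  have h3 : e * a * (c * (63 / 64 * q)) = 63 / 64 * (e * c ^+ 2).
    by rewrite -[in RHS]aqE -{1}aqE; ring.
  have h4 : 5 / 88 * (kappa ^+ 2 * B) <= e * c ^+ 2.
    rewrite ck; have -> : e * (kappa * B) ^+ 2 = e * B * (kappa ^+ 2 * B) by ring.
    by rewrite ler_pM2r ?mulr_gt0 ?exprn_gt0//; lra.
  rewrite -(ler_pM2r B0).
  rewrite h3 in h2.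
  have h5 : 63 / 64 * (63 / 64 * (e * c ^+ 2)) <= e * a * (33 / 5 * B * D).
    apply: le_trans h1.
    have -> : e * a * (63 / 64 * c * g) = 63 / 64 * (e * a * (c * g)) by ring.
    by rewrite ler_pM2l//; lra.
  have E2 : e * a * (33 / 5 * B * D) = 33 / 5 * (e * a * D * B) by ring.
  rewrite E2 in h5; have -> : 512 * (e * a * D) * B = 512 * (e * a * D * B) by ring.
  have : 0 <= kappa ^+ 2 * B by rewrite mulr_ge0 ?sqr_ge0// ltW.
  move: h4 h5; move: (kappa ^+ 2 * B) (e * c ^+ 2) (e * a * D * B) => X Y Z.
  by lra.
Qed.

End StepSizes.

(** * Deterministic analysis of a run with accurate queries *)

Section Run.
Context {R : realType} {d : nat} {S : Type}.
Variables (f : 'rV[R]_d -> R) (G : 'rV[R]_d -> S -> 'rV[R]_d).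
Variables (eta alpha : 'rV[R]_d -> R) (c : R) (r : \bar R).
Variables (x0 xstar : 'rV[R]_d) (s : nat -> S).

Local Notation x := (sgd_iterate G eta alpha r x0 s).
Local Notation R0 := (enorm (x0 - xstar)).

Definition clip_gradient t := G (x t) (s t.*2).
Definition clip_noise t := clip_gradient t - grad f (x t).
Definition step_noise t := G (x t) (s t.*2.+1) - grad f (x t).
Definition eff_step t := eta (clip_gradient t) * alpha (clip_gradient t).

(* Switched off outside the ball of radius 2 R0 around xstar, which keeps the
   noise walk subgaussian; on the good event the iterates never leave it. *)
Definition drift t : 'rV[R]_d :=
  if enorm (x t - xstar) <= 2 * R0 then (2 * eff_step t) *: (xstar - x t) else 0.

Definition noise_walk k : R := \sum_(t < k) edot (drift t) (step_noise t).

Variables (L0 L1 sigma' A : R) (T : nat).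
Hypotheses (L0_gt0 : 0 < L0) (L1_gt0 : 0 < L1) (R0_gt0 : 0 < R0).
Hypotheses (T_gt0 : (0 < T)%N) (A_ge0 : 0 <= A).
Hypothesis A_sigma' : sigma' ^+ 2 * T%:R = A ^+ 2 * R0 ^+ 2.
Hypotheses (r_gt0 : (0 < r)%E) (R0_le_r : (R0%:E <= r)%E).
Hypotheses (f_convex : is_convex f) (f_diff : twice_differentiable f).
Hypotheses (f_smooth : L0L1_smooth L0 L1 f) (f_min : forall y, f xstar <= f y).

Hypothesis steps : forall v : 'rV[R]_d, let q := enorm v in
  [/\ 0 < eta v * alpha v, eta v * alpha v * A <= 1 / 8,
      (forall g : R, 0 <= g -> `|q - g| <= sigma' ->
         eta v * alpha v * (L0 + L1 * g) <= 1 / 8),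
      (q < c -> 1 <= 16 * (11 * L0 + 2 * A) * (eta v * alpha v)) &
      (forall g D : R, 0 <= g -> c <= q -> `|q - g| <= sigma' ->
         g ^+ 2 <= 6 * (L0 + L1 * g) * D ->
         16 * R0 ^+ 2 <= T%:R * (eta v * alpha v * D))].

Let gap t := f (x t) - f xstar.

Let gap_ge0 t : 0 <= gap t.
Proof. by rewrite subr_ge0. Qed.

Let clip_close t : enorm (clip_noise t) <= sigma' ->
  `|enorm (clip_gradient t) - enorm (grad f (x t))| <= sigma'.
Proof.
move=> h; rewrite ler_norml; apply/andP; split.
  have := enormD (clip_gradient t) (- clip_noise t).
  rewrite enormN; have -> : clip_gradient t - clip_noise t = grad f (x t).
    by rewrite opprB addrC subrK.
  by lra.
have := enormD (clip_noise t) (grad f (x t)); rewrite subrK.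
by lra.
Qed.

(** Expanding the square, convexity contributes -2 g gap. The quadratic term is split as 2 g^2
    |grad|^2 + 2 g^2 |noise|^2: the first part is at most 2 * (6/8) g gap, the second at most 2 R0^2
    / (64 T), from (g A)^2 <= 1/64. *)
Let one_step t : enorm (clip_noise t) <= sigma' -> enorm (step_noise t) <= sigma' ->
  enorm (x t.+1 - xstar) ^+ 2 <= enorm (x t - xstar) ^+ 2
    - eff_step t * gap t / 2 + R0 ^+ 2 / 32 / T%:R
    + 2 * eff_step t * edot (xstar - x t) (step_noise t).
Proof.
move=> hc hn; have [g0 gA gL _ _] := steps (clip_gradient t).
rewrite -/(eff_step t) in g0 gA gL.
have T0 : 0 < T%:R :> R by rewrite ltr0n.
set gam := eff_step t in g0 gA gL *; set n := step_noise t in hn *.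
set gr := grad f (x t) in gL *.
apply: (@le_trans _ _ (enorm (x t - xstar - gam *: (gr + n)) ^+ 2)).
  rewrite ler_pXn2r ?nnegrE ?enorm_ge0//.
  have -> : x t - xstar - gam *: (gr + n) =
      x t - gam *: G (x t) (s t.*2.+1) - xstar.
    by rewrite /n /step_noise /gr subrKC addrAC.
  apply: eproj_eball_nonexpansive => //.
  by rewrite enormB.
move: gam g0 gA gL => gam g0 gA gL.
rewrite enorm_sqrD edotNr enormN enormZ edotZr edotDr exprMn real_normK ?num_real//.
have df : differentiable f (x t) by case: f_diff => df _; exact: df.
have := gap_le_edot_grad f (x t) xstar f_convex df; rewrite -/gr -/(gap t) => hgap.
have {}hgap : gam * gap t <= gam * edot (x t - xstar) gr.
  by rewrite ler_pM2l// edotC.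
have sq : enorm (gr + n) ^+ 2 <= 2 * enorm gr ^+ 2 + 2 * enorm n ^+ 2.
  have := sqr_ge0 (enorm (gr - n)).
  have -> : enorm (gr - n) ^+ 2 = enorm gr ^+ 2 - 2 * edot gr n + enorm n ^+ 2.
    by rewrite enorm_sqrD edotNr enormN mulrN.
  by rewrite enorm_sqrD; lra.
have h1 : gam ^+ 2 * enorm (gr + n) ^+ 2 <=
    gam ^+ 2 * (2 * enorm gr ^+ 2 + 2 * enorm n ^+ 2).
  by rewrite ler_pM2l// exprn_gt0.
have h2 : gam ^+ 2 * enorm gr ^+ 2 <= 3 / 4 * (gam * gap t).
  have := grad_sqr_le_gap f L0 L1 (x t) xstar f_diff f_smooth f_convex L0_gt0 L1_gt0 f_min.
  rewrite -/gr -/(gap t) => h.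
  have := gL _ (enorm_ge0 gr) (clip_close t hc); set K := L0 + _ in h * => gK.
  apply: (@le_trans _ _ (gam ^+ 2 * (6 * K * gap t))).
    by rewrite ler_pM2l// exprn_gt0.
  have -> : gam ^+ 2 * (6 * K * gap t) = 6 * (gam * K) * (gam * gap t) by ring.
  apply: ler_wpM2r; first by rewrite mulr_ge0 ?gap_ge0 ?(ltW g0).
  by lra.
have h3 : gam ^+ 2 * enorm n ^+ 2 <= R0 ^+ 2 / 64 / T%:R.
  apply: (@le_trans _ _ (gam ^+ 2 * sigma' ^+ 2)).
    rewrite ler_pM2l ?exprn_gt0// ler_pXn2r ?nnegrE ?enorm_ge0//.
    exact: le_trans (enorm_ge0 n) hn.
  rewrite ler_pdivlMr// -mulrA A_sigma' mulrA -exprMn mulrC ler_pM2l ?exprn_gt0//.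
  have : (gam * A) ^+ 2 <= (1 / 8) ^+ 2.
    by rewrite ler_pXn2r ?nnegrE ?mulr_ge0 ?divr_ge0 ?(ltW g0).
  by move=> h; rewrite (le_trans h)//; lra.
have -> : edot (xstar - x t) n = - edot (x t - xstar) n by rewrite -edotNl opprB.
have -> : R0 ^+ 2 / 32 / T%:R = 2 * (R0 ^+ 2 / 64 / T%:R) by field; rewrite gt_eqF.
move: h1 h2 h3 hgap; rewrite mulrDr; lra.
Qed.

Hypothesis small_clip_noise : forall t, (t < T)%N -> enorm (clip_noise t) <= sigma'.
Hypothesis small_step_noise : forall t, (t < T)%N -> enorm (step_noise t) <= sigma'.
Hypothesis small_walk : forall t, (t < T)%N -> noise_walk t.+1 <= 2 * R0 ^+ 2.

(** At step k the hypothesis and the walk bound give D_k^2 <= (1 + 1/32 + 2) R0^2 < 4 R0^2. So the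
    drift is not cut off, and the next increment of the walk is exactly the noise term of
    [one_step]. *)
Let progress k : (k <= T)%N ->
  enorm (x k - xstar) ^+ 2 <= R0 ^+ 2 - (\sum_(t < k) eff_step t * gap t) / 2
    + R0 ^+ 2 / 32 / T%:R * k%:R + noise_walk k.
Proof.
elim: k => [_|k IH kT].
  by rewrite /noise_walk !big_ord0; lra.
have T0 : 0 < T%:R :> R by rewrite ltr0n.
have {}IH := IH (ltnW kT).
have gap_sum : 0 <= \sum_(t < k) eff_step t * gap t.
  apply: sumr_ge0 => t _; apply: mulr_ge0 => //.
  by have [/ltW] := steps (clip_gradient t).
have walk_k : noise_walk k <= 2 * R0 ^+ 2.
  case: k kT {IH gap_sum} => [_|k kT]; last by apply: small_walk; exact: ltnW.
  by rewrite /noise_walk big_ord0 mulr_ge0// sqr_ge0.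
have kT1 : R0 ^+ 2 / 32 / T%:R * k%:R <= R0 ^+ 2 / 32.
  by rewrite mulrAC ler_pdivrMr// ler_pM2l ?divr_gt0 ?exprn_gt0// ler_nat ltnW.
have near_k : enorm (x k - xstar) <= 2 * R0.
  rewrite -(@ler_pXn2r _ 2)// ?nnegrE ?enorm_ge0 ?mulr_ge0 ?(ltW R0_gt0)//.
  by have := sqr_ge0 R0; rewrite exprMn; lra.
have := one_step k (small_clip_noise k kT) (small_step_noise k kT).
set e := _ * edot _ _; move=> step.
have -> : noise_walk k.+1 = noise_walk k + e.
  by rewrite /noise_walk big_ord_recr /= /drift near_k edotZl.
have -> : R0 ^+ 2 / 32 / T%:R * k.+1%:R =
    R0 ^+ 2 / 32 / T%:R * k%:R + R0 ^+ 2 / 32 / T%:R by rewrite -natr1; ring.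
rewrite big_ord_recr /= -/(sgd_iterate G eta alpha r x0 s k.+1).
by apply: (le_trans step); move: IH; move: (eff_step k * gap k) => u; lra.
Qed.

(** 256 = 16 * 8 * 2: the inverse of an unclipped step is at most 16 (11 L0 + 2 A), the total is at
    most 8 R0^2, and at least T / 2 steps are averaged. In particular the output is not the default
    [x0]. *)
Lemma sgd_gap_le :
  f (sgd_output G eta alpha c r x0 s T) - f xstar <=
    256 * (11 * L0 + 2 * A) * R0 ^+ 2 / T%:R.
Proof.
have T0 : 0 < T%:R :> R by rewrite ltr0n.
have step_gap_ge0 t : 0 <= eff_step t * gap t.
  by apply: mulr_ge0 => //; have [/ltW] := steps (clip_gradient t).
have total : \sum_(t < T) eff_step t * gap t <= 8 * R0 ^+ 2.
  have := progress T (leqnn T); rewrite divfK ?gt_eqF//.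
  have := sqr_ge0 (enorm (x T - xstar)); have := sqr_ge0 R0.
  have : noise_walk T <= 2 * R0 ^+ 2.
    by have := small_walk T.-1; rewrite prednK// => /(_ (leqnn _)).
  by lra.
set U := sgd_T2 G eta alpha c r x0 s T.
have UP (t : 'I_T) : (t \in U) = (enorm (clip_gradient t) < c) by rewrite inE.
have few_clipped : #|~: U|%:R * 2 <= T%:R :> R.
  have : \sum_(t in ~: U) 16 * R0 ^+ 2 / T%:R <= 8 * R0 ^+ 2.
    apply: le_trans total; rewrite [leRHS](bigID (mem (~: U))) /=.
    rewrite ler_wpDr ?sumr_ge0//; apply: ler_sum => t.
    rewrite !inE -leNgt => ct.
    have [_ _ _ _ /(_ (enorm (grad f (x t))) (gap t))] := steps (clip_gradient t).
    rewrite ler_pdivrMr// (mulrC _ T%:R); apply=> //; first exact: enorm_ge0.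
      exact: clip_close (small_clip_noise t (ltn_ord t)).
    exact: grad_sqr_le_gap.
  rewrite sumr_const -(mulr_natl (_ / _)) mulrA ler_pdivrMr//.
  have -> : #|~: U|%:R * (16 * R0 ^+ 2) = (8 * R0 ^+ 2) * (#|~: U|%:R * 2) by ring.
  by rewrite ler_pM2l// mulr_gt0// exprn_gt0.
have cardU : #|U|%:R + #|~: U|%:R = T%:R :> R by rewrite -natrD cardsC card_ord.
have half : T%:R <= 2 * #|U|%:R :> R by lra.
have U0 : U != finset.set0.
  by apply/eqP => U0; move: half; rewrite U0 cards0 mulr0; lra.
have K0 : 0 < 11 * L0 + 2 * A by rewrite ltr_wpDr ?mulr_gt0 ?mulr_ge0.
have gapU : \sum_(t in U) gap t <= 16 * (11 * L0 + 2 * A) * (8 * R0 ^+ 2).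
  apply: (@le_trans _ _ (\sum_(t in U) 16 * (11 * L0 + 2 * A) * (eff_step t * gap t))).
    apply: ler_sum => t; rewrite UP => tU; rewrite mulrA ler_peMl//.
    by have [_ _ _ /(_ tU)] := steps (clip_gradient t).
  rewrite -mulr_sumr ler_pM2l ?mulr_gt0//; apply: le_trans total.
  by rewrite [leRHS](bigID (mem U)) /= ler_wpDr ?sumr_ge0.
rewrite /sgd_output -/U (negbTE U0).
have df y : differentiable f y by case: f_diff => df _; exact: df.
have cU : 0 < #|U|%:R :> R by rewrite ltr0n card_gt0.
have := convex_mean_le f _ U (fun t : 'I_T => x t) f_convex df U0.
rewrite -(lerD2r (- f xstar)) => h; apply: (le_trans h).
have -> : #|U|%:R^-1 * (\sum_(t in U) f (x t)) - f xstar =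
    (\sum_(t in U) gap t) / #|U|%:R.
  rewrite sumrB sumr_const -(mulr_natl (f xstar)); field.
  by rewrite gt_eqF.
rewrite ler_pdivrMr// (le_trans gapU)//.
have -> : 256 * (11 * L0 + 2 * A) * R0 ^+ 2 / T%:R * #|U|%:R =
   16 * (11 * L0 + 2 * A) * (8 * R0 ^+ 2) * ((2 * #|U|%:R) / T%:R).
  by field; rewrite gt_eqF.
apply: ler_peMr; last by rewrite ler_pdivlMr// mul1r.
apply: mulr_ge0; first by apply: mulr_ge0; [|exact: ltW].
by apply: mulr_ge0; [|exact: sqr_ge0].
Qed.

End Run.

(** * Tail bounds for the queries and the noise walk *)

Section Tails.
Context {R : realType} {d : nat} {dO dS : measure_display}.
Context {Omega : measurableType dO} {S : measurableType dS}.
Variables (P : probability Omega R) (mu : probability S R).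
Variable (xi : nat -> {mfun Omega >-> S}).
Hypothesis xi_iid : iid P mu xi.

Lemma measurable_is_true dT (T : measurableType dT) (b : T -> bool) :
  measurable_fun setT b -> measurable [set t | b t].
Proof.
by move=> mb; have := mb measurableT [set true] I; rewrite setTI.
Qed.

Lemma exp_markov (W : Omega -> R) (a b : R) : measurable_fun setT W ->
  (\int[P]_w (expR (W w))%:E <= (expR b)%:E)%E ->
  (P [set w | (a < W w)%R] <= (expR (b - a))%:E)%E.
Proof.
move=> mW hW.
pose X : {RV P >-> R} := HB.pack W (isMeasurableFun.Build _ _ _ _ _ mW).
apply: (@le_trans _ _ (P [set w | (a <= X w)%R])).
  apply: le_measure; rewrite ?inE.
  - by apply: measurable_is_true; exact: measurable_fun_ltr.
  - by apply: measurable_is_true; exact: measurable_fun_ler.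
  - by move=> w /= /ltW.
apply: (le_trans (chernoff X a ltr01)).
rewrite mul1r addrC expRD EFinM muleC lee_wpmul2l ?lee_fin ?expR_ge0//.
rewrite /mmt_gen_fun unlock; under eq_integral do rewrite /= mulr1.
exact: hW.
Qed.

Variables (f : 'rV[R]_d -> R) (G : 'rV[R]_d -> S -> 'rV[R]_d) (sigma : R).
Hypotheses (f_diff : twice_differentiable f) (mG : measurable_oracle G).
Hypotheses (G_mean : unbiased_oracle mu G f).
Hypotheses (G_exp : subgaussian_oracle mu G f sigma) (sigma_gt0 : 0 < sigma).

Lemma measurable_grad dT (T : measurableType dT) (X : T -> borel_rV R d) :
  measurable_fun setT X ->
  measurable_fun setT (fun t => grad f (X t) : borel_rV R d).
Proof.
move=> mX; apply: measurable_fun_borel_rV => i.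
apply: (measurableT_comp (f := fun x : borel_rV R d => grad f x 0 i)) => //.
apply: continuous_measurable_borel_rV => x.
apply: (continuous_comp (f := grad f) (g := fun y : 'rV[R]_d => y 0 i)).
  exact: grad_continuous.
exact: coord_continuous.
Qed.

Lemma measurable_oracle_comp dT (T : measurableType dT)
    (X : T -> borel_rV R d) (Z : T -> S) :
  measurable_fun setT X -> measurable_fun setT Z ->
  measurable_fun setT (fun t => G (X t) (Z t) : borel_rV R d).
Proof.
move=> mX mZ.
exact: (measurableT_comp mG (measurable_fun_pair mX mZ)).
Qed.

Lemma noise_exp_le x :
  (\int[mu]_s (expR (enorm (G x s - grad f x) ^+ 2 / sigma ^+ 2))%:E
    <= (expR 1)%:E)%E.
Proof. by have := G_exp x; rewrite unlock. Qed.

Lemma measurable_noise x : measurable_fun setT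
  (fun s => G x s - grad f x : borel_rV R d).
Proof.
by apply: measurable_rVB => //; apply: measurable_oracle_comp.
Qed.

(** Unbiasedness is an identity in the extended reals; cancelling the gradient requires the
    finiteness given by [subgaussian_integrable]. *)
Lemma noise_mean x i : (\int[mu]_s ((G x s - grad f x) 0 i)%:E = 0)%E.
Proof.
have int_n := subgaussian_integrable mu _ sigma sigma_gt0 (measurable_noise x)
  (noise_exp_le x) i.
have := G_mean x i; rewrite unlock.
have -> : (\int[mu]_s (G x s 0 i)%:E =
    \int[mu]_s (((G x s - grad f x) 0 i)%:E + (grad f x 0 i)%:E))%E.
  by apply: eq_integral => s _; rewrite -EFinD !mxE subrK.
rewrite integralD//; last exact: finite_measure_integrable_cst.
rewrite integral_cst// [Y in (_ + _ * Y)%E](_ : _ = 1%E) ?mule1; last first.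
  exact: probability_setT.
have /fineK <- := integrable_fin_num measurableT int_n.
rewrite -EFinD => -[/eqP]; rewrite -[Y in _ == Y]add0r (inj_eq (addIr _)).
by move=> /eqP ->.
Qed.

(** The exponential moment holds at each fixed query point; a random point is allowed because it
    depends on the past only and seed k is fresh. *)
Lemma noise_tail k (X : Omega -> 'rV[R]_d) (L : R) : 0 <= L ->
  measurable_fun setT (X : past xi k -> borel_rV R d) ->
  (P [set w | 3 * Num.sqrt L * sigma < enorm (G (X w) (xi k w) - grad f (X w))]%R
    <= (expR (1 - 9 * L))%:E)%E.
Proof.
move=> L0 mX; pose W w := enorm (G (X w) (xi k w) - grad f (X w)) ^+ 2 / sigma ^+ 2.
have -> : [set w | 3 * Num.sqrt L * sigma < enorm (G (X w) (xi k w) - grad f (X w))]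
    = [set w | 9 * L < W w].
  have sq : 9 * L * sigma ^+ 2 = (3 * Num.sqrt L * sigma) ^+ 2.
    by rewrite !exprMn sqr_sqrtr//; ring.
  apply: eq_set => w; rewrite /W ltr_pdivlMr ?exprn_gt0// sq.
  by rewrite ltr_pXn2r ?nnegrE ?enorm_ge0// !mulr_ge0 ?sqrtr_ge0 ?(ltW sigma_gt0).
have mXO := measurable_fun_past xi k _ (borel_rV R d) X mX.
apply: exp_markov.
  apply: measurable_funM => //; apply: measurable_funX; apply: measurable_enorm.
  apply: measurable_rVB; last exact: measurable_grad.
  exact: measurable_oracle_comp.
have mh : measurable_fun setT (fun p : past xi k * S =>
    (expR (enorm (G (X p.1) p.2 - grad f (X p.1)) ^+ 2 / sigma ^+ 2))%:E).
  have mX1 : measurable_fun setT (fun p : past xi k * S => X p.1 : borel_rV R d).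
    exact: (measurableT_comp mX measurable_fst).
  apply/measurable_EFinP; apply: measurableT_comp => //.
  apply: measurable_funM => //; apply: measurable_funX; apply: measurable_enorm.
  apply: measurable_rVB; last exact: measurable_grad.
  exact: measurable_oracle_comp.
have h0 : forall p : past xi k * S,
    (0 <= (expR (enorm (G (X p.1) p.2 - grad f (X p.1)) ^+ 2 / sigma ^+ 2))%:E)%E.
  by move=> p; rewrite lee_fin expR_ge0.
rewrite (integral_fresh_seed P mu xi xi_iid k _ mh h0).
apply: (@le_trans _ _ (\int[P]_w (cst (expR 1)%:E w))%E); last first.
  rewrite integral_cst// [X in (_ * X)%E](_ : _ = 1%E) ?mule1//.
  exact: probability_setT.
apply: ge0_le_integral => //.
- by move=> w _; apply: integral_ge0 => s _; rewrite lee_fin expR_ge0.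
- exact: (measurable_fun_past xi k _ _ (fubini_F mu _)
    (measurable_fun_fubini_tonelli_F (m2 := mu) _ mh h0)).
- by move=> w _ /=; exact: (noise_exp_le (X w)).
Qed.

Variables (eta alpha : 'rV[R]_d -> R) (r : \bar R) (x0 xstar : 'rV[R]_d).
Hypotheses (meta : measurable_fun setT (eta : borel_rV R d -> R)).
Hypotheses (malpha : measurable_fun setT (alpha : borel_rV R d -> R)).
Hypothesis r_gt0 : (0 < r)%E.

Local Notation seeds w := (fun k => xi k w).
Local Notation X t := (fun w => sgd_iterate G eta alpha r x0 (seeds w) t).
Local Notation R0 := (enorm (x0 - xstar)).

Lemma measurable_past_iterate t :
  measurable_fun setT (X t : past xi t.*2 -> borel_rV R d).
Proof.
elim: t => [|t IH] //=; apply: measurable_eproj_eball => //.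
have mX : measurable_fun setT (X t : past xi t.*2.+2 -> borel_rV R d).
  by apply: (measurable_fun_past_lt xi t.*2) => //; exact: leq_trans (leqnSn _) _.
have mgc : measurable_fun setT (fun w : past xi t.*2.+2 =>
    G (X t w) (xi t.*2 w) : borel_rV R d).
  by apply: measurable_oracle_comp => //; exact: measurable_past_seed.
apply: measurable_rVB => //; apply: measurable_rVZ.
  apply: measurable_funM; first exact: (measurableT_comp meta mgc).
  exact: (measurableT_comp malpha mgc).
by apply: measurable_oracle_comp => //; exact: measurable_past_seed.
Qed.

(** Double sampling enters here: the drift uses seeds up to 2 t, including the clipping query, while
    the step noise uses seed 2 t + 1. *)
Lemma measurable_past_drift t : measurable_fun setT
  (fun w : past xi t.*2.+1 =>
     drift G eta alpha r x0 xstar (seeds w) t : borel_rV R d).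
Proof.
have mX : measurable_fun setT (X t : past xi t.*2.+1 -> borel_rV R d).
  by apply: (measurable_fun_past_lt xi t.*2) => //; exact: measurable_past_iterate.
have mgc : measurable_fun setT (fun w : past xi t.*2.+1 =>
    G (X t w) (xi t.*2 w) : borel_rV R d).
  by apply: measurable_oracle_comp => //; exact: measurable_past_seed.
rewrite /drift; apply: measurable_fun_ifT => //.
  apply: measurable_fun_ler => //; apply: measurable_enorm.
  exact: measurable_rVB.
apply: measurable_rVZ; last exact: measurable_rVB.
apply: measurable_funM => //.
apply: measurable_funM; first exact: (measurableT_comp meta mgc).
  exact: (measurableT_comp malpha mgc).
Qed.

Lemma measurable_past_walk k : measurable_fun setT
  (fun w : past xi k.*2 => noise_walk f G eta alpha r x0 xstar (seeds w) k).
Proof.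
apply: measurable_sum => t.
have tk : (t.*2.+2 <= k.*2)%N by rewrite -doubleS leq_double.
apply: measurable_edot.
  apply: (measurable_fun_past_lt xi t.*2.+1); first exact: ltnW.
  exact: measurable_past_drift.
have mX : measurable_fun setT (X t : past xi k.*2 -> borel_rV R d).
  apply: (measurable_fun_past_lt xi t.*2); last exact: measurable_past_iterate.
  exact: ltnW (ltnW tk).
apply: measurable_rVB; last exact: measurable_grad.
by apply: measurable_oracle_comp => //; exact: measurable_past_seed.
Qed.

(** The last increment is integrated over its own seed first, which costs a factor exp B whatever
    the past was. The cutoff in the drift is what permits such a deterministic [B]. *)
Lemma walk_mgf (lambda B : R) k :
  (forall s t, 2 * (enorm (lambda *: drift G eta alpha r x0 xstar s t) ^+ 2 *
     sigma ^+ 2) <= B) ->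
  (\int[P]_w (expR (lambda * noise_walk f G eta alpha r x0 xstar (seeds w) k))%:E
    <= (expR (k%:R * B))%:E)%E.
Proof.
move=> hB; elim: k => [|k IH].
  under eq_integral do rewrite /noise_walk big_ord0 mulr0.
  rewrite integral_cst// [p in (_ * p)%E](_ : _ = 1%E) ?mule1 ?mul0r//.
  exact: probability_setT.
pose D w := drift G eta alpha r x0 xstar (seeds w) k.
pose Y w := lambda * noise_walk f G eta alpha r x0 xstar (seeds w) k.
pose h (p : past xi k.*2.+1 * S) := (expR (Y p.1 +
  edot (lambda *: D p.1) (G ((X k) p.1) p.2 - grad f ((X k) p.1))))%:E.
have mY : measurable_fun setT (Y : past xi k.*2.+1 -> R).
  apply: measurable_funM => //; apply: (measurable_fun_past_lt xi k.*2) => //.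
  exact: measurable_past_walk.
have mh : measurable_fun setT h.
  have mX : measurable_fun setT (fun p : past xi k.*2.+1 * S => (X k) p.1 : borel_rV R d).
    apply: (measurableT_comp (f := (X k : past xi k.*2.+1 -> borel_rV R d))) => //.
    by apply: (measurable_fun_past_lt xi k.*2) => //; exact: measurable_past_iterate.
  apply/measurable_EFinP; apply: measurableT_comp => //; apply: measurable_funD.
    exact: (measurableT_comp mY measurable_fst).
  apply: measurable_edot.
    apply: measurable_rVZ => //.
    exact: (measurableT_comp (measurable_past_drift k) measurable_fst).
  apply: measurable_rVB; last exact: measurable_grad.
  exact: measurable_oracle_comp.
have h0 p : (0 <= h p)%E by rewrite lee_fin expR_ge0.
rewrite (eq_integral (fun w => h (w, xi k.*2.+1 w))) => [|w _]; last first.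
  by rewrite /h /Y /noise_walk big_ord_recr /= mulrDr edotZl.
rewrite (integral_fresh_seed P mu xi xi_iid _ _ mh h0).
apply: (@le_trans _ _ (\int[P]_w ((expR B)%:E * (expR (Y w))%:E))%E).
  apply: ge0_le_integral => //.
  - by move=> w _; exact: integral_ge0.
  - exact: (measurable_fun_past xi k.*2.+1 _ _ (fubini_F mu _)
      (measurable_fun_fubini_tonelli_F (m2 := mu) _ mh h0)).
  - apply: measurable_funeM; apply/measurable_EFinP; apply: measurableT_comp => //.
    exact: (measurable_fun_past xi k.*2.+1).
  - move=> w _; rewrite /h /=; under eq_integral do rewrite expRD EFinM.
    have mn := measurable_noise ((X k) w).
    rewrite ge0_integralZl//; last first.
      by apply/measurable_EFinP; apply: measurableT_comp => //; exact: measurable_edot.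
    rewrite muleC lee_wpmul2r// ?lee_fin ?expR_ge0//.
    have := subgaussian_mgf mu _ sigma sigma_gt0 mn (noise_exp_le _) (noise_mean _)
      (lambda *: D w).
    by move/le_trans; apply; rewrite lee_fin ler_expR; exact: hB.
rewrite ge0_integralZl//; last first.
  apply/measurable_EFinP; apply: measurableT_comp => //.
  exact: (measurable_fun_past xi k.*2.+1).
apply: (@le_trans _ _ ((expR B)%:E * (expR (k%:R * B))%:E)%E).
  by rewrite lee_wpmul2l ?lee_fin ?expR_ge0.
by rewrite lee_fin -expRD ler_expR -natr1; lra.
Qed.

End Tails.

(** * Measurability of the output *)

Section Output.
Context {R : realType} {d : nat}.

Lemma measurable_step_size m (L0 L1 R0 sigma' : R) T :
  0 < L0 -> 0 < L1 -> 0 <= sigma' -> 0 < R0 ->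
  measurable_fun setT (step_size m L0 L1 R0 sigma' T : borel_rV R d -> R).
Proof.
move=> L0_gt0 L1_gt0 sigma'_ge0 R0_gt0.
have -> : (step_size m L0 L1 R0 sigma' T : borel_rV R d -> R) =
  if m is ImplicitClipping then
    fun v => 8^-1 * (L0 + enorm v * L1 + sigma' * Num.sqrt T%:R / R0)^-1
  else cst (16^-1 * Num.min (11 * L0)^-1 (L0 + sigma' * Num.sqrt T%:R / R0)^-1).
  by case: m.
case: m => //; apply: measurable_funM => //; apply: measurable_funV => [|v].
  by do 2 apply: measurable_funD => //; apply: measurable_funM => //;
    exact: measurable_enorm.
by rewrite !addr_ge0 ?divr_ge0 ?mulr_ge0 ?enorm_ge0 ?sqrtr_ge0// ltW.
Qed.

Lemma measurable_clip_factor m (L0 L1 R0 sigma' delta : R) T :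
  measurable_fun setT
    (clip_factor m L0 L1 R0 sigma' delta T : borel_rV R d -> R).
Proof.
set c := clip_threshold m L0 L1 R0 sigma' delta T.
have -> : (clip_factor m L0 L1 R0 sigma' delta T : borel_rV R d -> R) =
  if m is ImplicitClipping then cst 1
  else fun v => if enorm v == 0 then 1 else Num.min 1 (c / enorm v).
  by rewrite /c; case: m {c} => //; apply/funext => v; rewrite enorm_eq0.
have mE : measurable_fun setT (fun v : borel_rV R d => enorm v).
  exact: measurable_enorm.
have mf : measurable_fun setT (fun v : borel_rV R d =>
    if enorm v == 0 then 1 else Num.min 1 (c / enorm v)).
  apply: measurable_fun_ifT => //; first exact: measurable_fun_eqr.
  apply: measurable_minr => //; apply: measurable_funM => //.
  by apply: measurable_funV => // v; exact: enorm_ge0.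
by case: m @c mf.
Qed.

(** The random index set is traded for sums of indicators, whose total N is its cardinal, so that N
    = 0 is the test for emptiness. *)
Lemma measurable_sgd_output dO (Omega : measurableType dO) (S : Type)
    (G : 'rV[R]_d -> S -> 'rV[R]_d) (eta alpha : 'rV[R]_d -> R) (c : R)
    (r : \bar R) (x0 : 'rV[R]_d) (s : Omega -> nat -> S) T :
  (forall t, measurable_fun setT
     (fun w => sgd_iterate G eta alpha r x0 (s w) t : borel_rV R d)) ->
  (forall t, measurable_fun setT
     (fun w => clip_gradient G eta alpha r x0 (s w) t : borel_rV R d)) ->
  measurable_fun setT
    (fun w => sgd_output G eta alpha c r x0 (s w) T : borel_rV R d).
Proof.
move=> mX mC; pose U w := sgd_T2 G eta alpha c r x0 (s w) T.
pose b t w := enorm (clip_gradient G eta alpha r x0 (s w) t) < c.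
have UP w (t : 'I_T) : (t \in U w) = b t w by rewrite inE.
have mb t : measurable_fun setT (b t).
  by apply: measurable_fun_ltr => //; exact: measurable_enorm.
pose N w : R := \sum_(t < T) (if b t w then 1 else 0).
have NE w : #|U w|%:R = N w.
  rewrite -sum1_card natr_sum big_mkcond /=.
  by apply: eq_bigr => t _; rewrite UP.
have mN : measurable_fun setT N.
  by apply: measurable_sum => t; exact: measurable_fun_ifT.
have -> : (fun w => sgd_output G eta alpha c r x0 (s w) T : borel_rV R d) =
  (fun w => if N w == 0 then x0 else (N w)^-1 *: \sum_(t < T)
     (if b t w then sgd_iterate G eta alpha r x0 (s w) t else 0)).
  apply/funext => w; rewrite /sgd_output -/(U w) -NE pnatr_eq0 cards_eq0.
  case: ifP => // _; congr (_ *: _); rewrite big_mkcond /=.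
  by apply: eq_bigr => t _; rewrite UP.
apply: measurable_fun_ifT => //; first exact: measurable_fun_eqr.
apply: measurable_rVZ.
  by apply: measurable_funV => // w; rewrite -NE ler0n.
apply: measurable_fun_borel_rV => i; under eq_fun do rewrite summxE.
apply: measurable_sum => t; apply: (measurable_coord (fun w =>
  if b t w then sgd_iterate G eta alpha r x0 (s w) t else 0)).
exact: measurable_fun_ifT.
Qed.

End Output.

(** * Failure probabilities and proof of the theorem *)

Lemma union_bound {R : realType} {dO} {Omega : measurableType dO}
    (P : probability Omega R) (B : nat -> set Omega) (n : nat) (b : R) :
  (forall t, measurable (B t)) ->
  (forall t, (t < n)%N -> (P (B t) <= b%:E)%E) ->
  (P (\big[setU/set0]_(t < n) B t) <= (n%:R * b)%:E)%E.
Proof.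
move=> mB; elim: n => [|n IH] Bb; first by rewrite big_ord0 mul0r measure0.
rewrite big_ord_recr /=.
apply: (le_trans (measureU2 _ _ _)) => //; first exact: bigsetU_measurable.
rewrite -natr1 mulrDl mul1r EFinD leeD ?Bb ?IH// => t tn.
exact: Bb (ltnW tn).
Qed.

Lemma expR1_le4 {R : realType} : expR 1 <= 4 :> R.
Proof.
have h : 1 / 2 <= expR (- (1 / 2)) :> R.
  by apply: le_trans (expR_ge1Dx _); lra.
have := expRxMexpNx_1 (1 / 2 : R).
have -> : expR 1 = expR (1 / 2) ^+ 2 :> R by rewrite -expRM_natl; congr expR; field.
have := expR_gt0 (1 / 2 : R); move: h; move: (expR _) (expR _) => u v; nra.
Qed.

(** The failure budget of one t: two inaccurate queries and one excursion of the walk. With q = exp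
    (- L) <= 1/2, each query costs e q^9 <= q / 2. *)
Lemma failure_le {R : realType} (L : R) : 0 <= L -> expR (- L) <= 1 / 2 ->
  2 * expR (1 - 9 * L) + expR (L / 18 - 2 * L) <= 2 * expR (- L).
Proof.
move=> L0; set q := expR (- L) => q2; have q0 : 0 < q := expR_gt0 _.
have h1 : expR (L / 18 - 2 * L) <= q by rewrite ler_expR; lra.
have h2 : expR (1 - 9 * L) = expR 1 * q ^+ 8 * q.
  by rewrite -mulrA -exprSr -expRM_natl -expRD; congr expR; ring.
have h3 : q ^+ 8 <= (1 / 2) ^+ 8 by rewrite ler_pXn2r ?nnegrE ?divr_ge0 ?(ltW q0).
have h4 : expR 1 * q ^+ 8 <= 4 * (1 / 2) ^+ 8.
  by rewrite ler_pM ?expR_ge0 ?expR1_le4// exprn_ge0// ltW.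
have h5 : expR 1 * q ^+ 8 * q <= 4 * (1 / 2) ^+ 8 * q by rewrite ler_pM2r.
rewrite h2; have : 4 * (1 / 2) ^+ 8 * q <= q / 2 by lra.
by lra.
Qed.

(** [L / R0 ^+ 2] is the Chernoff parameter. Squaring the step bound gives 576 g^2 sigma^2 L T <=
    R0^2, with 576 = (3 * 8)^2; inside the cutoff D^2 <= 4 R0^2, and 8 * 4 / 576 = 1/18. *)
Lemma drift_bound {R : realType} {d : nat} {S : Type}
    (G : 'rV[R]_d -> S -> 'rV[R]_d) (eta alpha : 'rV[R]_d -> R) (r : \bar R)
    (x0 xstar : 'rV[R]_d) (sigma L : R) (T : nat) :
  let R0 := enorm (x0 - xstar) in
  0 < R0 -> 0 < sigma -> 0 < L -> (0 < T)%N ->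
  (forall v, 0 < eta v * alpha v) ->
  (forall v, eta v * alpha v *
     (3 * Num.sqrt L * sigma * Num.sqrt T%:R / R0) <= 1 / 8) ->
  forall s t, 2 * (enorm ((L / R0 ^+ 2) *: drift G eta alpha r x0 xstar s t) ^+ 2 *
    sigma ^+ 2) <= L / 18 / T%:R.
Proof.
move=> R0 R0_gt0 sigma_gt0 L_gt0 T_gt0 g_gt0 gA s t.
have T0 : 0 < T%:R :> R by rewrite ltr0n.
rewrite /drift; case: ifP => [near_t|_]; last first.
  by rewrite scaler0 enorm0 expr0n mul0r mulr0 !divr_ge0 ?(ltW L_gt0).
set g := eff_step _ _ _ _ _ _ _.
have g0 : 0 < g by exact: g_gt0.
have {}gA : g * (3 * Num.sqrt L * sigma * Num.sqrt T%:R / R0) <= 1 / 8 by exact: gA.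
move: g g0 gA => g g0 gA; rewrite enormB in near_t.
rewrite scalerA enormZ exprMn real_normK ?num_real//.
set D := enorm _ in near_t *.
have D2 : D ^+ 2 <= 4 * R0 ^+ 2.
  have -> : 4 * R0 ^+ 2 = (2 * R0) ^+ 2 by ring.
  by rewrite ler_pXn2r ?nnegrE ?enorm_ge0 ?mulr_ge0 ?(ltW R0_gt0).
have gL : g ^+ 2 * sigma ^+ 2 * (L * T%:R) <= R0 ^+ 2 / 576.
  set X := g * _ in gA.
  have X0 : 0 <= X.
    rewrite mulr_ge0 ?(ltW g0)// divr_ge0 ?(ltW R0_gt0)//.
    by rewrite !mulr_ge0 ?sqrtr_ge0 ?(ltW sigma_gt0).
  have X2 : X ^+ 2 <= (1 / 8) ^+ 2 by rewrite ler_pXn2r ?nnegrE ?divr_ge0.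
  have E : X ^+ 2 * R0 ^+ 2 =
      9 * (g ^+ 2 * sigma ^+ 2 * (Num.sqrt L ^+ 2 * Num.sqrt T%:R ^+ 2)).
    by rewrite /X; field; rewrite gt_eqF.
  rewrite (sqr_sqrtr (ltW L_gt0)) (sqr_sqrtr (ler0n R T)) in E.
  have : X ^+ 2 * R0 ^+ 2 <= (1 / 8) ^+ 2 * R0 ^+ 2 by rewrite ler_pM2r ?exprn_gt0.
  by rewrite E; move: (R0 ^+ 2) (_ * (L * _)) => y z; lra.
rewrite ler_pdivlMr//.
have -> : 2 * ((L / R0 ^+ 2 * (2 * g)) ^+ 2 * D ^+ 2 * sigma ^+ 2) * T%:R =
  8 * L / R0 ^+ 4 * ((g ^+ 2 * sigma ^+ 2 * (L * T%:R)) * D ^+ 2).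
  by field; rewrite gt_eqF.
apply: (@le_trans _ _ (8 * L / R0 ^+ 4 * (R0 ^+ 2 / 576 * (4 * R0 ^+ 2)))).
  rewrite ler_wpM2l//.
    apply: divr_ge0; first by apply: mulr_ge0 => //; exact: ltW.
    by apply: exprn_ge0; exact: ltW.
  apply: ler_pM => //; last exact: sqr_ge0.
  by apply: mulr_ge0; apply: mulr_ge0; rewrite ?sqr_ge0 ?(ltW L_gt0).
have -> : 8 * L / R0 ^+ 4 * (R0 ^+ 2 / 576 * (4 * R0 ^+ 2)) = L / 18.
  by field; rewrite gt_eqF.
by [].
Qed.

Theorem theorem1 (R : realType) :
  exists C : R, 0 < C /\
  forall (d : nat) (f : 'rV[R]_d -> R) (L0 L1 sigma : R)
    (x0 xstar : 'rV[R]_d) (r : \bar R)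
    (dS : measure_display) (S : measurableType dS) (mu : probability S R)
    (G : 'rV[R]_d -> S -> 'rV[R]_d)
    (dO : measure_display) (Omega : measurableType dO)
    (P : probability Omega R) (xi : nat -> {mfun Omega >-> S})
    (delta : R) (T : nat) (m : clipping_method),
  let R0 := enorm (x0 - xstar) in
  let sigma' := 3 * Num.sqrt (ln (T%:R / delta)) * sigma in
  0 < L0 -> 0 < L1 -> 0 < sigma -> 0 < R0 ->
  (0 < r)%E -> (R0%:E <= r)%E ->
  is_convex f -> twice_differentiable f -> L0L1_smooth L0 L1 f ->
  (forall x, f xstar <= f x) ->
  measurable_oracle G -> unbiased_oracle mu G f ->
  subgaussian_oracle mu G f sigma ->
  iid P mu xi ->
  0 < delta -> delta < 1 -> (0 < T)%N ->
  log_plus (T%:R / delta) * (64 * L1 * R0) ^+ 2 <= T%:R ->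
  let xbar (w : Omega) :=
    sgd_output G (step_size m L0 L1 R0 sigma' T)
      (clip_factor m L0 L1 R0 sigma' delta T)
      (clip_threshold m L0 L1 R0 sigma' delta T)
      r x0 (fun k => xi k w) T in
  ((1 - 2 * delta)%:E <=
   P [set w | (f (xbar w) - f xstar <=
     C * (log_plus (T%:R / delta) *
          (L0 * R0 ^+ 2 +
           Num.sqrt (ln (T%:R / delta)) * sigma * R0 * Num.sqrt T%:R)
          / T%:R))%R])%E.
Proof.
(* 11 * 256 is the coefficient of L0 R0^2 in the final bound; the noise term only has 256 * 2 *
   3. *)
exists (11 * 16 ^+ 2); split; first by rewrite mulr_gt0 ?exprn_gt0.
move=> d f L0 L1 sigma x0 xstar r dS S mu G dO Omega P xi delta T m
  R0 sigma' L0_gt0 L1_gt0 sigma_gt0 R0_gt0 r_gt0 R0_le_r f_convex f_diff f_smooth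
  f_min mG G_mean G_exp xi_iid delta_gt0 delta_lt1 T_gt0 T_large.
rewrite /is_true -/(is_true _).
(* For 2 delta >= 1 the claimed probability is at most 0. Otherwise T / delta > 2, which makes L
   positive and exp (- L) at most 1/2. *)
have [delta_large|delta_small] := leP 1 (2 * delta).
  by apply: le_trans (measure_ge0 _ _); rewrite lee_fin; lra.
set L := ln (T%:R / delta) in sigma' T_large *.
have T0 : 0 < T%:R :> R by rewrite ltr0n.
have T1 : 1 <= T%:R :> R by rewrite ler1n.
have ratio_gt2 : 2 <= T%:R / delta by rewrite ler_pdivlMr//; lra.
have L_gt0 : 0 < L by apply: ln_gt0; lra.
have expNL : expR (- L) = delta / T%:R.
  by rewrite expRN /L lnK ?invf_div// posrE divr_gt0.
have log_ge2 : 2 <= log_plus (T%:R / delta) by rewrite /log_plus -/L; lra.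
have sigma'_gt0 : 0 < sigma' by rewrite !mulr_gt0// sqrtr_gt0.
pose A := sigma' * Num.sqrt T%:R / R0.
have A_ge0 : 0 <= A.
  by rewrite divr_ge0 ?(ltW R0_gt0)// mulr_ge0 ?sqrtr_ge0// ltW.
have steps := @step_bounds R d m L0 L1 R0 sigma' delta T
  L0_gt0 L1_gt0 R0_gt0 (ltW sigma'_gt0) T_gt0 log_ge2 T_large.
set eta := step_size m L0 L1 R0 sigma' T in steps *.
set alpha := clip_factor m L0 L1 R0 sigma' delta T in steps *.
set c := clip_threshold m L0 L1 R0 sigma' delta T in steps *.
have meta : measurable_fun setT (eta : borel_rV R d -> R).
  by apply: measurable_step_size => //; exact: ltW.
have malpha : measurable_fun setT (alpha : borel_rV R d -> R).
  exact: measurable_clip_factor.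
pose seeds w k := xi k w.
have mX t : measurable_fun setT
    (fun w => sgd_iterate G eta alpha r x0 (seeds w) t : borel_rV R d).
  exact: (measurable_fun_past xi t.*2 _ _ _
    (measurable_past_iterate xi G mG eta alpha r x0 meta malpha r_gt0 t)).
have mC t : measurable_fun setT
    (fun w => clip_gradient G eta alpha r x0 (seeds w) t : borel_rV R d).
  exact: measurable_oracle_comp.
have mN t : measurable_fun setT
    (fun w => clip_noise f G eta alpha r x0 (seeds w) t : borel_rV R d).
  by apply: measurable_rVB => //; exact: measurable_grad.
have mM t : measurable_fun setT
    (fun w => step_noise f G eta alpha r x0 (seeds w) t : borel_rV R d).
  apply: measurable_rVB; last exact: measurable_grad.
  exact: measurable_oracle_comp.
have mW t : measurable_fun setT
    (fun w => L / R0 ^+ 2 * noise_walk f G eta alpha r x0 xstar (seeds w) t).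
  apply: measurable_funM => //; apply: (measurable_fun_past xi t.*2).
  exact: measurable_past_walk.
set rate := 11 * 16 ^+ 2 * _; set good := [set w | _].
have mgood : measurable good.
  apply: measurable_is_true; apply: measurable_fun_ler => //.
  apply: measurable_funB => //.
  apply: (measurableT_comp (f := f : borel_rV R d -> R)).
    apply: continuous_measurable_borel_rV => x.
    by apply: differentiable_continuous; case: f_diff.
  exact: measurable_sgd_output.
pose bad1 t := [set w | sigma' < enorm (clip_noise f G eta alpha r x0 (seeds w) t)].
pose bad2 t := [set w | sigma' < enorm (step_noise f G eta alpha r x0 (seeds w) t)].
(* The event that the walk exceeds 2 R0^2 after t + 1 steps, rescaled by the Chernoff parameter. *)
pose bad3 t := [set w | 2 * L <
  L / R0 ^+ 2 * noise_walk f G eta alpha r x0 xstar (seeds w) t.+1].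
pose bad t := bad1 t `|` bad2 t `|` bad3 t.
have mb1 t : measurable (bad1 t).
  apply: measurable_is_true; apply: measurable_fun_ltr => //.
  exact: measurable_enorm.
have mb2 t : measurable (bad2 t).
  apply: measurable_is_true; apply: measurable_fun_ltr => //.
  exact: measurable_enorm.
have mb3 t : measurable (bad3 t).
  by apply: measurable_is_true; exact: measurable_fun_ltr.
have mbad t : measurable (bad t) by do 2 apply: measurableU => //.
have Pbad t : (t < T)%N -> (P (bad t) <= (2 * (delta / T%:R))%:E)%E.
  move=> tT.
  have P1 : (P (bad1 t) <= (expR (1 - 9 * L))%:E)%E.
    apply: (noise_tail P mu xi xi_iid f G sigma f_diff mG G_exp sigma_gt0 t.*2
      (fun w => sgd_iterate G eta alpha r x0 (seeds w) t) L (ltW L_gt0)).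
    exact: measurable_past_iterate.
  have P2 : (P (bad2 t) <= (expR (1 - 9 * L))%:E)%E.
    apply: (noise_tail P mu xi xi_iid f G sigma f_diff mG G_exp sigma_gt0 t.*2.+1
      (fun w => sgd_iterate G eta alpha r x0 (seeds w) t) L (ltW L_gt0)).
    apply: (measurable_fun_past_lt xi t.*2) => //.
    exact: measurable_past_iterate.
  have P3 : (P (bad3 t) <= (expR (L / 18 - 2 * L))%:E)%E.
    apply: exp_markov => //.
    have hB := drift_bound G eta alpha r x0 xstar sigma L T R0_gt0 sigma_gt0 L_gt0
      T_gt0 (fun v => let: And5 h _ _ _ _ := steps v in h)
      (fun v => let: And5 _ h _ _ _ := steps v in h).
    apply: (le_trans (walk_mgf P mu xi xi_iid f G sigma f_diff mG G_mean G_exp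
      sigma_gt0 eta alpha r x0 xstar meta malpha r_gt0 _ _ t.+1 hB)).
    rewrite lee_fin ler_expR mulrA ler_pdivrMr// mulrC.
    by rewrite ler_pM2l ?divr_gt0// ler_nat.
  rewrite -expNL; apply: (@le_trans _ _
      ((2 * expR (1 - 9 * L) + expR (L / 18 - 2 * L))%:E)%E); last first.
    rewrite lee_fin failure_le ?(ltW L_gt0)// expNL ler_pdivrMr//; lra.
  apply: (le_trans (measureU2 _ _ _)) => //; first exact: measurableU.
  rewrite EFinD leeD//; apply: (le_trans (measureU2 _ _ _)) => //.
  by rewrite mulr2n mulrDl mul1r EFinD leeD.
have := union_bound P bad T _ mbad Pbad; set fail := \big[_/_]_(_ < _) _.
have -> : T%:R * (2 * (delta / T%:R)) = 2 * delta by field; rewrite gt_eqF.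
move=> Pfail.
have mfail : measurable fail by exact: bigsetU_measurable.
apply: (@le_trans _ _ (P (~` fail))).
  rewrite probability_setC// EFinB leeB//.
apply: le_measure; rewrite ?inE//; first exact: measurableC.
move=> w nfail.
have nbad t : (t < T)%N -> ~ bad t w.
  move=> tT bt; apply: nfail; rewrite /fail -bigcup_mkord.
  by exists t.
have A_sigma' : sigma' ^+ 2 * T%:R = A ^+ 2 * R0 ^+ 2.
  have E : A ^+ 2 * R0 ^+ 2 = sigma' ^+ 2 * Num.sqrt T%:R ^+ 2.
    by rewrite /A; field; rewrite gt_eqF.
  by rewrite E (sqr_sqrtr (ler0n R T)).
have := sgd_gap_le f G eta alpha c r x0 xstar (seeds w) L0 L1 sigma' A T
  L0_gt0 L1_gt0 R0_gt0 T_gt0 A_ge0 A_sigma' r_gt0 R0_le_r f_convex f_diff f_smooth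
  f_min steps.
have bad1N t : (t < T)%N -> enorm (clip_noise f G eta alpha r x0 (seeds w) t) <= sigma'.
  by move=> tT; rewrite leNgt; apply/negP => h; apply: (nbad t tT); left; left.
have bad2N t : (t < T)%N -> enorm (step_noise f G eta alpha r x0 (seeds w) t) <= sigma'.
  by move=> tT; rewrite leNgt; apply/negP => h; apply: (nbad t tT); left; right.
have bad3N t : (t < T)%N ->
    noise_walk f G eta alpha r x0 xstar (seeds w) t.+1 <= 2 * R0 ^+ 2.
  move=> tT; rewrite leNgt; apply/negP => h; apply: (nbad t tT); right.
  rewrite /bad3 /=; have -> : 2 * L = L / R0 ^+ 2 * (2 * R0 ^+ 2).
    by field; rewrite gt_eqF.
  by rewrite ltr_pM2l// divr_gt0// exprn_gt0.
move=> /(_ bad1N bad2N bad3N); rewrite /good /= => /le_trans; apply.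
rewrite /rate mulrA ler_pM2r ?invr_gt0//.
have AE : A * R0 ^+ 2 = 3 * (Num.sqrt L * sigma * R0 * Num.sqrt T%:R).
  by rewrite /A /sigma'; field; rewrite gt_eqF.
have -> : 256 * (11 * L0 + 2 * A) * R0 ^+ 2 =
  11 * 16 ^+ 2 * (L0 * R0 ^+ 2) + 2 * 16 ^+ 2 * (A * R0 ^+ 2) by ring.
rewrite AE; set u := L0 * R0 ^+ 2; set v := _ * Num.sqrt T%:R.
have u0 : 0 <= u by rewrite mulr_ge0 ?sqr_ge0 ?(ltW L0_gt0).
have v0 : 0 <= v.
  by rewrite !mulr_ge0 ?sqrtr_ge0 ?(ltW sigma_gt0) ?(ltW R0_gt0).
apply: (@le_trans _ _ (11 * 16 ^+ 2 * (1 * (u + v)))); first lra.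
rewrite ler_pM2l ?mulr_gt0 ?exprn_gt0//.
by rewrite ler_wpM2r ?addr_ge0//; lra.
Qed.
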